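(* Let $k$ be a field, $R=k[x_1,\dots,x_n]$, and let $I\subseteq R$ be the edge ideal of a graph $\mathcal H$ with at least one edge on the vertex set $V=\{1,\dots,n\}$. Let $\overline{\mathcal H}$ denote the graph on $V$ of the non-edges of $\mathcal H$. Then $\operatorname{depth} R/I^2>1$ if and only if the following conditions are satisfied: (a) $\operatorname{diam}\overline{\mathcal H}\le 2$; (b) for every triangle $U$ of $\mathcal H$, the set $\overline{N(U)}=V\setminus N(U)$ has at least two elements and the induced subgraph $\overline{\mathcal H}|_{\overline{N(U)}}$ is connected.
   Context: A graph on $V$ is a collection of 2-element subsets of $V$ (edges). The edge ideal of $\mathcal H$ is the ideal of $R$ generated by all $x_ix_j$ with $\{i,j\}\in\mathcal H$. Depth is taken with respect to $(x_1,\dots,x_n)$. $\overline{\mathcal H}$ has vertex set $V$ and edges all 2-element subsets of $V$ which are not in $\mathcal H$. A triangle of $\mathcal H$ here means the set $U$ of the three vertices of a triangle. $N(U)$ is the set of all vertices adjacent in $\mathcal H$ to some vertex of $U$. The diameter of a graph is the maximal distance between two of its vertices, where distance is the minimal length of a path joining them ($\infty$ if there is none). The induced subgraph $\overline{\mathcal H}|_W$ has vertex set $W$ and all edges of $\overline{\mathcal H}$ contained in $W$. *)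

(* Defs.v *)
From HB Require Import structures.
From mathcomp Require Import all_boot all_order all_algebra.
From mathcomp Require Import mpoly.
From Stdlib Require Import ClassicalEpsilon.

Set Implicit Arguments.
Unset Strict Implicit.
Unset Printing Implicit Defensive.

Import GRing.Theory.

(** Extended natural numbers; [None] is infinity. *)
Definition enat := option nat.

Definition le_enat (a b : enat) : bool :=
  match a, b with
  | _, None => true
  | None, Some _ => false
  | Some m, Some n => m <= n
  end.

Definition lt_enat (a b : enat) : bool := ~~ le_enat b a.

Definition max_enat (a b : enat) : enat := if le_enat a b then b else a.

Section Graphs.
Variable V : finType.
Implicit Types (H : {set {set V}}) (U W : {set V}).

Definition is_graph H : Prop := forall e, e \in H -> #|e| = 2.

Definition adj H : rel V := fun x y => [set x; y] \in H.

Definition gcompl H : {set {set V}} := [set e : {set V} | (#|e| == 2) && (e \notin H)].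

Definition induced H W : {set {set V}} := [set e in H | e \subset W].

(** The subgraph induced on [W] is connected; vacuous for empty [W]. *)
Definition is_connected H W : Prop :=
  forall x y, x \in W -> y \in W -> connect (adj (induced H W)) x y.

Definition is_triangle H U : Prop :=
  #|U| = 3 /\ forall x y, x \in U -> y \in U -> x != y -> adj H x y.

(** [U] is not removed: [U \subset nbhd H U] when [U] is a triangle. *)
Definition nbhd H U : {set V} := [set x | [exists u in U, adj H u x]].

Definition path_of_length H (x y : V) (d : nat) : bool :=
  [exists p : d.-tuple V,
     [&& path (adj H) x p, uniq (x :: p) & last x p == y]].

Lemma path_of_lengthP H x y :
  connect (adj H) x y -> exists d, path_of_length H x y d.
Proof.
case/connectP=> p pP ->; case/shortenP: pP => q qP qU _.
exists (size q); apply/existsP; exists (in_tuple q).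
by apply/and3P; split.
Qed.

Definition dist H (x y : V) : enat :=
  match @idP (connect (adj H) x y) with
  | ReflectT xy => Some (ex_minn (path_of_lengthP xy))
  | ReflectF _ => None
  end.

Definition diam H : enat :=
  \big[max_enat/Some 0]_(x : V) \big[max_enat/Some 0]_(y : V) dist H x y.

End Graphs.

Local Open Scope ring_scope.

Section Ideals.
Variable R : comNzRingType.
Implicit Types (I J G : R -> Prop) (s : seq R).

(** The ideal generated by [G]. *)
Definition ideal_gen G : R -> Prop := fun p =>
  exists2 c : seq (R * R), (forall ag, ag \in c -> G ag.2)
                         & p = \sum_(ag <- c) ag.1 * ag.2.

Definition ideal_mul I J : R -> Prop :=
  ideal_gen (fun p => exists a b, [/\ I a, J b & p = a * b]).

(** [J + (f_1, ..., f_r)] for [s = [:: f_1; ...; f_r]]. *)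
Definition ideal_add_seq J s : R -> Prop :=
  ideal_gen (fun p => J p \/ p \in s).

(** [s] is a regular sequence on the [R]-module [R/J] ([J] an ideal): each
    [f_i] is a nonzerodivisor on [R/(J + (f_1, ..., f_(i-1)))], and
    [R/(J + (f_1, ..., f_r))] is nonzero. *)
Definition regular_seq J s : Prop :=
  (forall i, (i < size s)%N -> forall g,
     ideal_add_seq J (take i s) (s`_i * g) -> ideal_add_seq J (take i s) g)
  /\ ~ ideal_add_seq J s 1.

Definition regular_seq_in I J (d : nat) : Prop :=
  exists s, [/\ size s = d, forall f, f \in s -> I f & regular_seq J s].

Definition is_max_regular_length I J (d : nat) : Prop :=
  regular_seq_in I J d /\ forall d', regular_seq_in I J d' -> (d' <= d)%N.

(** The depth of [R/J] with respect to the ideal [I]: the maximal length of an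
    [R/J]-regular sequence in [I], and infinity if there is no maximum (the
    lengths are unbounded, or [J = R] and no sequence is regular). *)
Definition depth_quot I J : enat :=
  match excluded_middle_informative (exists d, is_max_regular_length I J d) with
  | left ex => Some (proj1_sig (constructive_indefinite_description _ ex))
  | right _ => None
  end.

End Ideals.

Section EdgeIdeal.
Variables (k : fieldType) (n : nat).

Definition vars_ideal : {mpoly k[n]} -> Prop :=
  ideal_gen (fun p => exists i : 'I_n, p = 'X_i).

Definition edge_ideal (H : {set {set 'I_n}}) : {mpoly k[n]} -> Prop :=
  ideal_gen (fun p => exists i j : 'I_n, adj H i j /\ p = 'X_i * 'X_j).

End EdgeIdeal.

(* Main.v *)
Require Import Defs.
From HB Require Import structures.
From mathcomp Require Import all_boot all_order all_algebra.
From mathcomp Require Import mpoly ring zify.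
From Stdlib Require Import ClassicalEpsilon.

(** For a monomial ideal J not containing 1, let the graph of an exponent m have
    as vertices the i for which x^m stays outside J after inverting X_i, and as
    edges the pairs {i, j} for which it does after inverting X_i X_j; this is the
    1-skeleton of Takayama's degree complex.  The depth of R/J exceeds 1 if and
    only if, for every x^m outside J, this graph is connected with at least two
    vertices.
    If the graphs are connected, the sum of the variables is regular, and so is
    the complete symmetric polynomial h_2 modulo it: after inverting X_i one may
    eliminate X_i, whereupon h_2 becomes a quadric containing all the squares X_j^2
    with j <> i, so its zero divisors are torsion; the local quotients then
    glue along the graphs, one exponent at a time.  Conversely, a regular
    sequence of length two makes sections over the punctured spectrum extend,
    which forbids isolated vertices and separations.
    For J = I^2, x^m lies outside J if and only if the edges inside the support of m
    are absent, or all contain a vertex of exponent 1, or lie in a triangle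
    of exponents 1.  The graphs of x_i x_j and x_i x_j x_l, for an edge and
    a triangle, give conditions (a) and (b); all other graphs are then
    connected through a suitable hub. *)

Set Implicit Arguments.
Unset Strict Implicit.
Unset Printing Implicit Defensive.

Import GRing.Theory.

(** * Ideals and regular sequences *)

Section Ideals.
Local Open Scope ring_scope.
Variable R : comNzRingType.
Implicit Types (Q J : R -> Prop) (p q z f g : R).

Record ideal Q : Prop := Ideal {
  ideal0 : Q 0;
  idealD : forall p q, Q p -> Q q -> Q (p + q);
  idealM : forall p q, Q q -> Q (p * q) }.

Lemma idealN Q p : ideal Q -> Q p -> Q (- p).
Proof. by move=> idQ Qp; rewrite -mulN1r; apply: idealM. Qed.

Lemma idealB Q p q : ideal Q -> Q p -> Q q -> Q (p - q).
Proof. by move=> idQ Qp Qq; apply: idealD => //; apply: idealN. Qed.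

Lemma ideal_sum Q (I : Type) (r : seq I) (A : pred I) (F : I -> R) :
  ideal Q -> (forall i, A i -> Q (F i)) -> Q (\sum_(i <- r | A i) F i).
Proof. by move=> [Q0 QD _] QF; apply: big_ind. Qed.

Lemma ideal_congr Q p q : ideal Q -> Q (p - q) -> Q q -> Q p.
Proof. by move=> idQ Qpq Qq; rewrite -[p](subrK q); apply: idealD. Qed.

Lemma ideal_gen_ideal (G : R -> Prop) : ideal (ideal_gen G).
Proof.
split.
- by exists [::] => //; rewrite big_nil.
- move=> p q [c Gc ->] [d Gd ->]; exists (c ++ d); last by rewrite big_cat.
  by move=> ag; rewrite mem_cat => /orP[/Gc|/Gd].
- move=> p q [c Gc ->]; exists [seq (p * ag.1, ag.2) | ag <- c].
    by move=> ag /mapP[ag' /Gc ? ->].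
  by rewrite big_map mulr_sumr; apply: eq_bigr => ag _; rewrite mulrA.
Qed.

Lemma sub_ideal_gen (G : R -> Prop) p : G p -> ideal_gen G p.
Proof.
move=> Gp; exists [:: (1, p)]; last by rewrite big_seq1 mul1r.
by move=> ag; rewrite inE => /eqP->.
Qed.

Lemma ideal_gen_min (G Q : R -> Prop) p :
  ideal Q -> (forall q, G q -> Q q) -> ideal_gen G p -> Q p.
Proof.
move=> idQ GQ [c Gc ->]; rewrite big_seq; apply: ideal_sum => // ag agc.
by apply: idealM => //; apply/GQ/Gc.
Qed.

Lemma ideal_add_nil J p : ideal J -> ideal_add_seq J [::] p <-> J p.
Proof.
move=> idJ; split; last by move=> Jp; apply: sub_ideal_gen; left.
by apply: ideal_gen_min => // q [|].
Qed.

Lemma ideal_add1 J f p :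
  ideal J -> ideal_add_seq J [:: f] p <-> exists w, J (p - f * w).
Proof.
move=> idJ; split; last first.
  case=> w Jw; have idA := ideal_gen_ideal (fun q => J q \/ q \in [:: f]).
  apply: (ideal_congr (q := f * w) idA); first by apply: sub_ideal_gen; left.
  by rewrite mulrC; apply: idealM => //; apply: sub_ideal_gen; right; rewrite inE.
apply: (ideal_gen_min (Q := fun p => exists w, J (p - f * w))) => [|q [Jq|]].
- split.
  + by exists 0; rewrite mulr0 subr0; apply: ideal0.
  + move=> a b [u Ju] [v Jv]; exists (u + v).
    suff -> : a + b - f * (u + v) = (a - f * u) + (b - f * v) by apply: idealD.
    by ring.
  + move=> a b [v Jv]; exists (a * v).
    suff -> : a * b - f * (a * v) = a * (b - f * v) by apply: idealM.
    by ring.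
- by exists 0; rewrite mulr0 subr0.
- by rewrite inE => /eqP->; exists 1; rewrite mulr1 subrr; apply: ideal0.
Qed.

Lemma regular_seq2P J f g : ideal J ->
  regular_seq J [:: f; g] <->
  [/\ forall z, J (f * z) -> J z,
      forall z w, J (g * z - f * w) -> exists w', J (z - f * w')
    & ~ ideal_add_seq J [:: f; g] 1].
Proof.
move=> idJ; split.
  case=> reg n1; split=> // [z Jfz|z w Jgz].
    by apply/(ideal_add_nil _ idJ)/(reg 0) => //=; apply/(ideal_add_nil _ idJ).
  by apply/(ideal_add1 _ _ idJ)/(reg 1) => //=; apply/(ideal_add1 _ _ idJ); exists w.
case=> regf regg n1; split=> // -[|[|i]] //= _ z.
  by move=> /(ideal_add_nil _ idJ)/regf/(ideal_add_nil _ idJ).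
by move=> /(ideal_add1 _ _ idJ)[w /regg[w' Jw']]; apply/(ideal_add1 _ _ idJ); exists w'.
Qed.

(** In each term of the binomial expansion either the exponent of [p] is at least [a] or that of [q]
    is at least [b]. *)
Lemma ideal_powD Q p q z a b : ideal Q ->
  Q (p ^+ a * z) -> Q (q ^+ b * z) -> Q ((p + q) ^+ (a + b) * z).
Proof.
move=> idQ Qp Qq; rewrite exprDn mulr_suml; apply: ideal_sum => // i _.
rewrite -mulr_natl -mulrA; apply: idealM => //.
have [lt_ib|le_bi] := ltnP i b.
  have -> : (a + b - i = (b - i) + a)%N by lia.
  rewrite exprD; set u := p ^+ (b - i).
  suff -> : u * p ^+ a * q ^+ i * z = u * q ^+ i * (p ^+ a * z) by apply: idealM.
  by ring.
rewrite -(subnK le_bi) exprD; set u := q ^+ (i - b); set v := p ^+ _.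
suff -> : v * (u * q ^+ b) * z = v * u * (q ^+ b * z) by apply: idealM.
by ring.
Qed.

Lemma ideal_pow_sum Q (I : Type) (r : seq I) (A : pred I) (F : I -> R) z :
  ideal Q -> (forall i, A i -> exists a, Q (F i ^+ a * z)) ->
  exists a, Q ((\sum_(i <- r | A i) F i) ^+ a * z).
Proof.
move=> idQ QF; apply: (big_ind (fun p => exists a, Q (p ^+ a * z))) => //.
  by exists 1%N; rewrite expr1 mul0r; apply: ideal0.
by move=> p q [a Qp] [b Qq]; exists (a + b)%N; apply: ideal_powD.
Qed.

Lemma regular_exp J f a :
  (forall z, J (f * z) -> J z) -> forall z, J (f ^+ a * z) -> J z.
Proof. by move=> reg; elim: a => [|a IH] z; rewrite ?mul1r // exprS -mulrA => /reg/IH. Qed.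

(** Powers of [g] follow by iteration. For powers of [f], one factor [f] is split off [z] and
    cancelled by the regularity of [f]; the induction then applies to the quotient [z1]. *)
Lemma regular_mod_exp J f g a b : ideal J ->
  (forall z, J (f * z) -> J z) ->
  (forall z w, J (g * z - f * w) -> exists w', J (z - f * w')) ->
  forall z w, J (g ^+ b * z - f ^+ a * w) -> exists w', J (z - f ^+ a * w').
Proof.
move=> idJ regf regg.
have reggb : forall z w, J (g ^+ b * z - f * w) -> exists w', J (z - f * w').
  elim: b => [|b IH] z w; first by rewrite mul1r; exists w.
  by rewrite exprS -mulrA => /regg[w' /IH].
elim: a => [|a IH] z w Jz.
  by exists z; rewrite mul1r subrr; apply: ideal0.
have [z1 Jz1] : exists w', J (z - f * w').
  by apply: (reggb _ (f ^+ a * w)); rewrite mulrA -exprS.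
have [|w' Jw'] := IH z1 w.
  apply: regf.
  have -> : f * (g ^+ b * z1 - f ^+ a * w) =
            (g ^+ b * z - f ^+ a.+1 * w) - g ^+ b * (z - f * z1).
    by rewrite exprS; ring.
  by apply: idealB => //; apply: idealM.
exists w'.
have -> : z - f ^+ a.+1 * w' = (z - f * z1) + f * (z1 - f ^+ a * w').
  by rewrite exprS; ring.
by apply: idealD => //; apply: idealM.
Qed.

End Ideals.

(** * Monomial ideals and their degree complexes *)

Section MonomialIdeals.
Local Open Scope ring_scope.
Variables (k : fieldType) (n : nat).
Implicit Types (P : pred 'X_{1..n}) (p q z : {mpoly k[n]}) (m : 'X_{1..n}).

Definition msupported P p : Prop := forall m, m \in msupp p -> P m.

(** Thus [P] is the exponent set of a monomial ideal generated by monomials with all exponents at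
    most [K]; raising an exponent beyond [K] changes nothing. *)
Definition saturated K P : Prop := forall m m' : 'X_{1..n},
  P m -> (forall i, minn (m i) K <= m' i)%N -> P m'.

Lemma saturated_le K P m m' :
  saturated K P -> (m <= m')%MM -> P m -> P m'.
Proof. by move=> satP /mnm_lepP le_m Pm; apply: (satP _ _ Pm) => i; have := le_m i; lia. Qed.

Lemma msupportedP P p :
  msupported P p <-> forall m, ~~ P m -> p@_m = 0.
Proof.
split=> [Jp m nPm|Jp m pm]; last first.
  by apply: contraLR pm => /Jp/eqP; rewrite mcoeff_eq0.
by apply: memN_msupp_eq0; apply: contra nPm => /Jp.
Qed.

Lemma mcoeffXM m p m' :
  ('X_[m] * p)@_m' = if (m <= m')%MM then p@_(m' - m) else 0.
Proof.
rewrite mulrC; case: ifP => [/submK {1}<-|nle]; first by rewrite addmC mcoeffMX.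
apply: memN_msupp_eq0; rewrite (perm_mem (msuppMX p m)).
by apply: contraFN nle => /mapP[m1 _ ->]; apply: lem_addr.
Qed.

Lemma mcoeffXMD m p m' : ('X_[m] * p)@_(m + m') = p@_m'.
Proof. by rewrite mulrC mcoeffMX. Qed.

Lemma msupported_ideal K P : saturated K P -> ideal (msupported P).
Proof.
move=> satP; split=> [m|p q Jp Jq m|p q Jq m].
- by rewrite msupp0.
- by move=> /msuppD_le; rewrite mem_cat => /orP[/Jp|/Jq].
- move=> /msuppM_le/allpairsP[[m1 m2] /= [_ /Jq Pm ->]].
  exact: saturated_le satP (lem_addl _ _) Pm.
Qed.

Lemma msupportedX P m : msupported P ('X_[m] : {mpoly k[n]}) <-> P m.
Proof.
rewrite /msupported msuppX; split=> [->|Pm m'] //; first exact: mem_head.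
by rewrite inE => /eqP->.
Qed.

(** Localization at [X_i]: by saturation the [K]-th power already decides what inverting [X_i] puts
    into the ideal. *)
Definition locm K P (i : 'I_n) : pred 'X_{1..n} := fun m => P (m + U_(i) *+ K)%MM.

Lemma locm_saturated K P i : saturated K P -> saturated K (locm K P i).
Proof.
move=> satP m m' Pm le_m; apply: (satP _ _ Pm) => j.
by have := le_m j; rewrite !mnmDE mulmnE mnm1E; case: eqP => _ /=; lia.
Qed.

Lemma sub_locm K P i m : saturated K P -> P m -> locm K P i m.
Proof. by move=> satP; apply: saturated_le satP (lem_addr _ _). Qed.

Lemma msupported_locm K P i p :
  msupported (locm K P i) p <-> msupported P ('X_[U_(i) *+ K] * p).
Proof.
split=> /msupportedP Jp; apply/msupportedP => m nPm.
  rewrite mcoeffXM; case: ifP => // le_m; apply: Jp.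
  by rewrite /locm submK.
by rewrite -(mcoeffXMD (U_(i) *+ K)); apply: Jp; rewrite addmC.
Qed.

(* By descending induction on the exponent of ['X_j] in a monomial [b] of [z]:
   those of larger exponent are already torsion, so the coefficient of [h * z]
   at [b + d e_j] comes, up to torsion, only from the pure power of ['X_j]. *)
Lemma homog_torsion K P (j : 'I_n) d (h z : {mpoly k[n]}) :
  saturated K P -> h \is d.-homog -> h@_(U_(j) *+ d) != 0 ->
  msupported P (h * z) -> msupported (locm K P j) z.
Proof.
move=> satP homh hj Jhz; have satPj : saturated K (locm K P j) := locm_saturated satP.
suff H t (b : 'X_{1..n}) : (msize z - b j <= t)%N -> b \in msupp z -> locm K P j b.
  by move=> b; apply: H (leqnn _).
elim: t b => [|t IH] b le_t bz.
  have := msize_mdeg_lt bz; move: le_t; rewrite mdegE (bigD1 j) //=; lia.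
have bjz : (b j < msize z)%N.
  have := msize_mdeg_lt bz; rewrite mdegE (bigD1 j) //=; lia.
have locE (m : 'X_{1..n}) : locm K P j (U_(j) *+ d + m)%MM -> locm K P j m.
  move/satP; apply=> i; rewrite !mnmDE !mulmnE mnm1E.
  by case: eqP => _ /=; lia.
apply/negPn/negP => nb.
have nPd : ~~ P (U_(j) *+ d + b)%MM.
  by apply: contra nb => /(sub_locm j satP)/locE.
have /msupportedP/(_ _ nPd)/eqP := Jhz; apply/negP.
rewrite mcoeffM.
set D := (U_(j) *+ d + b)%MM.
have ltd : (mdeg (U_(j) *+ d) < (mdeg D).+1)%N by rewrite mdegD; lia.
have ltb : (mdeg b < (mdeg D).+1)%N by rewrite mdegD; lia.
rewrite (bigD1 (BMultinom ltd, BMultinom ltb)) //= big1 ?addr0.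
  by rewrite mulf_neq0 // -mcoeff_msupp.
case=> [[m1 lt1] [m2 lt2]] /= /andP[/eqP eqD neq].
have [|/eqP hm1] := boolP (h@_m1 == 0); first by move/eqP->; rewrite mul0r.
have [/eqP->|zm2] := boolP (z@_m2 == 0); first by rewrite mulr0.
move/eqP: hm1; rewrite -mcoeff_msupp => hm1.
have deg1 : mdeg m1 = d by have /dhomogP/(_ _ hm1) := homh.
have eqDi i : ((j == i) * d + b i = m1 i + m2 i)%N.
  have := congr1 (fun m : 'X_{1..n} => m i) eqD.
  by rewrite /D !mnmDE mulmnE mnm1E.
have m1j : (m1 j < d)%N.
  rewrite ltn_neqAle -{2}deg1 mdegE (bigD1 j) //= leq_addr andbT.
  apply: contra neq => /eqP m1j.
  have m1E : m1 = (U_(j) *+ d)%MM.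
    apply/mnmP => i; rewrite mulmnE mnm1E; case: eqP => [<-|/eqP ji].
      by rewrite mul1n.
    move: deg1; rewrite mdegE (bigD1 j) //= (bigD1 i) 1?eq_sym //=; lia.
  have m2E : m2 = b.
    by apply/mnmP => i; have := eqDi i; rewrite m1E mulmnE mnm1E; lia.
  by apply/eqP; congr pair; apply/val_inj.
have := eqDi j; rewrite eqxx mul1n => eqDj.
have m2b : locm K P j m2 by apply: IH; [lia | rewrite mcoeff_msupp].
case/negP: nb; apply: (locE); apply: satPj m2b _ => i.
have := eqDi i; rewrite mnmDE mulmnE mnm1E; lia.
Qed.

(* The degree complex of [m] up to dimension 1: for a [K]-saturated [P], [X_i^K] stands for
   every large power of ['X_i], and [i] is a vertex when [~~ locm K P i m]. *)
Definition degree_rel K P m : rel 'I_n :=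
  fun i j => ~~ P (m + U_(i) *+ K + U_(j) *+ K)%MM.

Definition degree_connected K P m : Prop :=
  (exists i j, [/\ i != j, ~~ locm K P i m & ~~ locm K P j m]) /\
  (forall i j, ~~ locm K P i m -> ~~ locm K P j m ->
     connect (degree_rel K P m) i j).

Lemma locm_gammar K P m i j :
  saturated K P -> degree_rel K P m i j -> ~~ locm K P i m.
Proof. by move=> satP; apply: contra => /(saturated_le satP)->//; apply: lem_addr. Qed.

Lemma degree_rel_sym K P m i j : degree_rel K P m i j = degree_rel K P m j i.
Proof. by rewrite /degree_rel -addmA [X in P (_ + X)%MM]addmC addmA. Qed.

Lemma connect_step (T : finType) (e : rel T) x y :
  connect e x y -> x != y -> exists2 z, z != x & e x z.
Proof.
case/connectP=> s es ->; case/shortenP: es => -[|z s'] /=; first by rewrite eqxx.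
case/andP=> exz _ /andP[]; rewrite inE negb_or eq_sym => /andP[nzx _] _ _ _.
by exists z.
Qed.

(** A second vertex exists, so the first proper step of a path towards it leaves [i]. *)
Lemma degree_neighbour K P m i : degree_connected K P m -> ~~ locm K P i m ->
  exists2 j, j != i & degree_rel K P m i j.
Proof.
case=> [[x [y [nxy xP yP]]] conn] iP.
have [eix|nix] := eqVneq i x; last exact: (connect_step (conn i x iP xP)).
by apply: (connect_step (conn i y iP yP)); rewrite eix.
Qed.

(** An exponent outside [P] has a vertex, so it is still visible on one of the charts where some
    [X_i] is inverted. *)
Lemma torsion_free K P p : saturated K P ->
  (forall m, ~~ P m -> degree_connected K P m) ->
  (forall i, msupported P ('X_[U_(i) *+ K] * p)) -> msupported P p.
Proof.
move=> satP good Jp; apply/msupportedP => m nPm.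
have [[i [j [_ iP _]]] _] := good m nPm.
by move/msupportedP: (proj2 (msupported_locm _ _ _ _) (Jp i)); apply.
Qed.

(** The local quotients of ['X_[U_(i) *+ K] * W i] by [X_i^N] are glued one exponent at a time:
    every vertex of the graph of [b] proposes a coefficient of [w] at [b], and connectedness makes
    the proposals agree. *)
Lemma glue K N P (W : 'I_n -> {mpoly k[n]}) : saturated K P -> (K <= N)%N ->
  (forall m, ~~ P m -> degree_connected K P m) ->
  (forall i j, msupported P ('X_[U_(j) *+ N] * ('X_[U_(i) *+ K] * W i)
                           - 'X_[U_(i) *+ N] * ('X_[U_(j) *+ K] * W j))) ->
  exists w, forall i, msupported P ('X_[U_(i) *+ N] * w - 'X_[U_(i) *+ K] * W i).
Proof.
move=> satP leKN good compat.
have [V VE] : exists V : 'I_n -> {mpoly k[n]}, forall i, V i = 'X_[U_(i) *+ K] * W i.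
  by exists (fun i => 'X_[U_(i) *+ K] * W i).
(* The default 0 is only reached for [b] in [P], where the coefficient is irrelevant. *)
pose c b : k := if [pick i | ~~ P (b + U_(i) *+ N)%MM] is Some i
                then (V i)@_(b + U_(i) *+ N) else 0.
(* Beyond degree [D] all proposed coefficients vanish, so [w] is a finite sum. *)
pose D := \max_i msize (V i).
pose w : {mpoly k[n]} := \sum_(b : 'X_{1..n < D}) c b *: 'X_[b].
have wE b : w@_b = c b.
  have [ltb|leb] := ltnP (mdeg b) D; first exact: mcoeff_mpoly.
  have -> : c b = 0.
    rewrite /c; case: pickP => // i _; apply/memN_msupp_eq0/msize_mdeg_ge.
    rewrite mdegD (leq_trans _ (leq_addr _ _)) // (leq_trans _ leb) //.
    exact: (leq_bigmax (F := fun i => msize (V i))).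
  rewrite /w raddf_sum /= big1 // => -[b' ltb'] _ /=.
  rewrite mcoeffZ mcoeffX; case: eqP => [bb'|]; last by rewrite mulr0.
  by move: ltb'; rewrite bb' ltnNge leb.
have coefE m i j : ~~ P (m + U_(j) *+ N)%MM ->
    (V i)@_m = if (U_(i) *+ N <= m + U_(j) *+ N)%MM
               then (V j)@_(m + U_(j) *+ N - U_(i) *+ N) else 0.
  move=> nP; have /msupportedP/(_ _ nP) := compat i j.
  rewrite -!VE mcoeffB mcoeffXM lem_addl addmK mcoeffXM => /eqP.
  by rewrite subr_eq0 => /eqP.
have bigP m i : ~~ locm K P i m -> ~~ P (m + U_(i) *+ N)%MM.
  apply: contra => /satP; apply=> l.
  by rewrite !mnmDE !mulmnE mnm1E; case: (i == l) => /=; lia.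
exists w => i; rewrite -VE; apply/msupportedP => m nPm.
(* If [m i < N], the coefficient of [V i] at [m] must vanish. It does when [m i < K], as [X_i^K]
   divides [V i]; otherwise [i] is a vertex of [m], and comparison with a neighbour [j] would
   require [X_i^N] to divide a monomial in which [X_i] has exponent [m i]. *)
rewrite mcoeffB mcoeffXM; case: ifP => [le_im|nle_im]; last first.
  rewrite sub0r; apply/eqP; rewrite oppr_eq0 VE mcoeffXM; case: ifP => // le_Km.
  rewrite -[_@__](mcoeffXMD (U_(i) *+ K)) addmC submK // -VE.
  have miN : (m i < N)%N.
    rewrite ltnNge; apply: contraFN nle_im => le_N; apply/mnm_lepP => l.
    by rewrite mulmnE mnm1E; case: eqP => [<-|] //; rewrite mul1n.
  have miK : (K <= m i)%N by move/mnm_lepP/(_ i): le_Km; rewrite mulmnE mnm1E eqxx mul1n.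
  have iP : ~~ locm K P i m.
    apply: contra nPm => /satP; apply=> l.
    by rewrite !mnmDE !mulmnE mnm1E; case: eqP => [<-|_] /=; lia.
  have [j nji gij] := degree_neighbour (good m nPm) iP.
  have jP : ~~ locm K P j m by apply: locm_gammar satP _; rewrite degree_rel_sym; apply: gij.
  rewrite (coefE m i j) ?bigP //; case: ifP => // /mnm_lepP/(_ i).
  by rewrite mnmDE !mulmnE !mnm1E eqxx (negPf nji); lia.
set b := (m - U_(i) *+ N)%MM; rewrite wE.
have mE : m = (b + U_(i) *+ N)%MM by rewrite submK.
have nPb : ~~ P b by apply: contra nPm; apply: saturated_le satP _; apply: lem_subr.
have locN j : ~~ P (b + U_(j) *+ N)%MM -> ~~ locm K P j b.
  apply: contra; rewrite /locm => Pb; apply: saturated_le satP _ Pb.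
  by apply/mnm_lepP => l; rewrite !mnmDE leq_add2l !mulmnE leq_mul2l leKN orbT.
(* Adjacent vertices propose the same coefficient, hence so do the ends of a path. *)
have constV i1 i2 : degree_rel K P b i1 i2 ->
    (V i1)@_(b + U_(i1) *+ N) = (V i2)@_(b + U_(i2) *+ N).
  move=> g12; rewrite (coefE _ i1 i2); last first.
    apply: contra g12 => /satP; apply=> l; rewrite !mnmDE !mulmnE !mnm1E.
    by case: (i1 == l); case: (i2 == l) => /=; lia.
  rewrite -addmA [X in (_ + X)%MM]addmC addmA lem_addl.
  by congr (mcoeff _ _); apply: addmK.
rewrite [in X in _ - X]mE /c; case: pickP => [i0 i0P|/(_ i)]; last by rewrite -mE nPm.
apply/eqP; rewrite subr_eq0; apply/eqP.
have [_ /(_ i0 i (locN _ i0P))] := good b nPb.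
have iP : ~~ locm K P i b by apply: locN; rewrite -mE.
move=> /(_ iP)/connectP[s gs ->].
by elim: s i0 gs {i0P} => [|i1 s IH] i0 //= /andP[/constV -> /IH].
Qed.

End MonomialIdeals.

(** * The sum of the variables and the quadric h_2 *)

Section RegularPair.
Local Open Scope ring_scope.
Variables (k : fieldType) (n : nat).
Implicit Types (P : pred 'X_{1..n}) (p q z : {mpoly k[n]}) (m : 'X_{1..n}).

Definition sumX : {mpoly k[n]} := \sum_i 'X_i.

(** The complete homogeneous symmetric polynomial of degree 2. In the same argument a second linear
    form would need pairwise distinct coefficients, which a small field lacks; this quadric serves
    over every field. *)
Definition hsym2 : {mpoly k[n]} := \sum_(i < n) 'X_i * \sum_(j < n | (j <= i)%N) 'X_j.

(** Solving [sumX = 0] for [X_i]; substitution along this tuple is reduction modulo [sumX]. *)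
Definition elim_var (i : 'I_n) : n.-tuple {mpoly k[n]} :=
  [tuple if l == i then - \sum_(j | j != i) 'X_j else 'X_l | l < n].

Lemma elim_varE i l :
  tnth (elim_var i) l = if l == i then - \sum_(j | j != i) 'X_j else 'X_l.
Proof. by rewrite tnth_mktuple. Qed.

Lemma comp_elim_varX i l : 'X_l \mPo elim_var i = tnth (elim_var i) l.
Proof. by rewrite comp_mpolyXU -tnth_nth. Qed.

Lemma comp_elim_sumX i : sumX \mPo elim_var i = 0.
Proof.
rewrite /sumX rmorph_sum /= (bigD1 i) //= comp_elim_varX elim_varE eqxx.
apply/eqP; rewrite addrC subr_eq0; apply/eqP/eq_bigr => j nji.
by rewrite comp_elim_varX elim_varE (negPf nji).
Qed.

Lemma comp_elim_congr i p : exists q, p - (p \mPo elim_var i) = sumX * q.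
Proof.
pose congr (x y : {mpoly k[n]}) := exists q, x - y = sumX * q.
have congrM x x' y y' : congr x x' -> congr y y' -> congr (x * y) (x' * y').
  move=> [q xq] [r yr]; exists (q * y + x' * r).
  have -> : x * y - x' * y' = (x - x') * y + x' * (y - y') by ring.
  by rewrite xq yr; ring.
have congr1 : congr 1 1 by exists 0; rewrite subrr mulr0.
have congrX l : congr 'X_l (tnth (elim_var i) l).
  rewrite elim_varE; case: eqP => [->|_]; last by exists 0; rewrite subrr mulr0.
  by exists 1; rewrite mulr1 opprK /sumX [in RHS](bigD1 i).
elim/mpolyind: p => [|c m p _ _ [q pq]].
  by exists 0; rewrite comp_mpoly0 subrr mulr0.
have [r mr] : congr 'X_[m] ('X_[m] \mPo elim_var i).
  rewrite comp_mpolyX mpolyXE_id.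
  apply: (big_ind2 congr congr1 congrM) => l _.
  by elim: (m l) => [|a IH]; rewrite ?expr0 // !exprS; apply: congrM.
exists (c%:MP * r + q); rewrite comp_mpolyD comp_mpolyZ -!mul_mpolyC opprD addrACA.
by rewrite pq -mulrBr mr; ring.
Qed.

(** The substitution only replaces [X_i], and once [X_i] is inverted its exponent does not influence
    membership. *)
Lemma comp_elim_locm K P i p : saturated K P ->
  msupported P p -> msupported (locm K P i) (p \mPo elim_var i).
Proof.
move=> satP Jp; have idJ := msupported_ideal k (locm_saturated (i := i) satP).
rewrite comp_mpolyEX big_seq; apply: (ideal_sum _ idJ) => m /Jp Pm.
rewrite -mul_mpolyC; apply: (idealM idJ); rewrite comp_mpolyX (bigD1 i) //=.
apply: (idealM idJ).
pose m' := [multinom if l == i then 0%N else m l | l < n].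
have -> : \prod_(l | l != i) tnth (elim_var i) l ^+ m l = 'X_[m'].
  rewrite mpolyXE_id [RHS](bigD1 i) //= mnmE eqxx mul1r.
  by apply: eq_bigr => l nli; rewrite elim_varE mnmE (negPf nli).
apply/msupportedX; apply: satP Pm _ => l.
by rewrite mnmDE mulmnE mnm1E mnmE [l == i]eq_sym; case: eqP => [<-|_] /=; lia.
Qed.

Lemma dhomogXU (i : 'I_n) : ('X_i : {mpoly k[n]}) \is 1.-homog.
Proof. by rewrite dhomogX /= mdeg1. Qed.

Lemma sumX_homog : sumX \is 1.-homog.
Proof. by apply: rpred_sum => i _; apply: dhomogXU. Qed.

Lemma comp_hsym2E i : hsym2 \mPo elim_var i =
  \sum_(l < n) tnth (elim_var i) l * \sum_(j < n | (j <= l)%N) tnth (elim_var i) j.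
Proof.
rewrite /hsym2 rmorph_sum; apply: eq_bigr => l _ /=.
rewrite rmorphM rmorph_sum /= comp_elim_varX; congr (_ * _).
by apply: eq_bigr => j _; apply: comp_elim_varX.
Qed.

Lemma comp_hsym2_homog i : hsym2 \mPo elim_var i \is 2.-homog.
Proof.
have h1 l : tnth (elim_var i) l \is 1.-homog.
  rewrite elim_varE; case: eqP => _; rewrite ?rpredN ?dhomogXU //.
  by apply: rpred_sum => j _; apply: dhomogXU.
rewrite comp_hsym2E; apply: rpred_sum => l _; apply: (dhomogM (d := 1) (e := 1)) => //.
by apply: rpred_sum => j _.
Qed.

(** At the [j]-th unit vector only pure powers of [X_j] survive, and homogeneity leaves a single
    one. *)
Lemma homog_meval_delta (j : 'I_n) d p :
  p \is d.-homog -> p.@[fun l => (l == j)%:R] = p@_(U_(j) *+ d).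
Proof.
move=> /dhomogP homp; rewrite mevalE.
have monE m : m \in msupp p ->
    \prod_i ((i == j)%:R : k) ^+ m i = (m == (U_(j) *+ d)%MM)%:R.
  move=> /homp degm; case: eqP => [->|neq].
    rewrite big1 // => i _; rewrite mulmnE mnm1E eq_sym.
    by case: eqP; rewrite ?mul0n ?expr1n.
  have [i /andP[nij mi]|all0] := pickP (fun i => (i != j) && (m i != 0%N)).
    by rewrite (bigD1 i) //= (negPf nij) expr0n (negPf mi) mul0r.
  case: neq; have m0 i : i != j -> m i = 0%N.
    by move=> nij; move/negbT: (all0 i); rewrite nij negbK => /eqP.
  have mj : m j = d by rewrite -degm /= mdegE (bigD1 j) //= big1 ?addn0.
  apply/mnmP => i; rewrite mulmnE mnm1E; case: eqP => [<-|/eqP]; first by rewrite mul1n.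
  by rewrite eq_sym => /m0.
rewrite big_seq (eq_bigr (fun m => p@_m * (m == (U_(j) *+ d)%MM)%:R)); last first.
  by move=> m /monE->.
rewrite -big_seq; have [Dp|nDp] := boolP ((U_(j) *+ d)%MM \in msupp p).
  rewrite (bigD1_seq _ Dp) ?msupp_uniq //= eqxx mulr1 big1 ?addr0 // => m neq.
  by rewrite (negPf neq) mulr0.
rewrite (memN_msupp_eq0 nDp) big_seq big1 // => m mp.
by case: eqP nDp => [<-|]; rewrite ?mp ?mulr0.
Qed.

Lemma sum_delta (A : pred 'I_n) (j : 'I_n) :
  \sum_(l < n | A l) ((l == j)%:R : k) = (A j)%:R.
Proof.
have [Aj|nAj] := boolP (A j).
  by rewrite (bigD1 j) //= eqxx big1 ?addr0 // => l /andP[_ /negPf->].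
by rewrite big1 // => l Al; case: eqP nAj => [<-|]; rewrite ?Al.
Qed.

Lemma sum_delta_mul (F : 'I_n -> k) (j : 'I_n) :
  \sum_(l < n) (l == j)%:R * F l = F j.
Proof.
by rewrite (bigD1 j) //= eqxx mul1r big1 ?addr0 // => l /negPf->; rewrite mul0r.
Qed.

(** The coefficient is the value at the unit vector of [j]. Elimination turns this point into
    [e_j - e_i], where h_2 takes the value 1 - 1 + 1. *)
Lemma comp_hsym2_coeff i j :
  i != j -> (hsym2 \mPo elim_var i)@_(U_(j) *+ 2) = 1.
Proof.
move=> nij; rewrite -(homog_meval_delta j (comp_hsym2_homog i)) comp_hsym2E.
pose v (l : 'I_n) : k := (l == j)%:R - (l == i)%:R.
have meval_sum (u : 'I_n -> k) (A : pred 'I_n) (F : 'I_n -> {mpoly k[n]}) :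
    (\sum_(l | A l) F l).@[u] = \sum_(l | A l) (F l).@[u].
  exact: (raddf_sum (meval u)).
have vE l : (tnth (elim_var i) l).@[fun l => (l == j)%:R] = v l.
  rewrite elim_varE /v; case: eqP => [->|_]; last by rewrite mevalXU subr0.
  rewrite mevalN meval_sum (eq_bigr (fun l : 'I_n => (l == j)%:R)); last first.
    by move=> l' _; rewrite mevalXU.
  by rewrite (sum_delta (fun l => l != i)) eq_sym nij (negPf nij) sub0r.
rewrite meval_sum (eq_bigr (fun l : 'I_n => v l * ((j <= l)%N%:R - (i <= l)%N%:R))).
  rewrite /v (eq_bigr _ (fun l _ => mulrBl _ _ _)) sumrB !sum_delta_mul !leqnn.
  case: ltngtP nij => [_|_|/val_inj->] //; rewrite ?eqxx // => _.
    by rewrite subrr sub0r opprB subr0.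
  by rewrite subrr !subr0.
move=> l _; rewrite mevalM vE meval_sum; congr (_ * _).
rewrite (eq_bigr v) ?sumrB; last by move=> l' _; apply: vE.
by rewrite !(sum_delta (fun l' : 'I_n => (l' <= l)%N)).
Qed.

Lemma sumX_regular K P z : saturated K P ->
  (forall m, ~~ P m -> degree_connected K P m) ->
  msupported P (sumX * z) -> msupported P z.
Proof.
move=> satP good Jz; apply: (torsion_free satP good) => i.
apply/msupported_locm; apply: (homog_torsion satP sumX_homog _ Jz).
rewrite mulm1n /sumX raddf_sum /= (bigD1 i) //= mcoeffXU eqxx big1 ?addr0 ?oner_eq0 //.
by move=> j /negPf nji; rewrite mcoeffXU nji.
Qed.

(** On the chart of [X_i], eliminating [X_i] kills [sumX] and leaves a quadric containing the
    squares of all other variables. Their sum is therefore nilpotent on the image of [v]; modulo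
    [sumX] this sum is [- X_i]. *)
Lemma hsym2_local K P i u v : saturated K P ->
  msupported P (hsym2 * v - sumX * u) ->
  exists N w, msupported P ('X_[U_(i) *+ (N + K)] * v - sumX * ('X_[U_(i) *+ K] * w)).
Proof.
move=> satP J0; set Pi := locm K P i.
have satPi : saturated K Pi := locm_saturated satP.
have idPi := msupported_ideal k satPi.
set psi := fun p => p \mPo elim_var i.
have Jpsi : msupported Pi (psi hsym2 * psi v).
  have := comp_elim_locm (i := i) satP J0.
  by rewrite rmorphB !rmorphM /= comp_elim_sumX mul0r subr0.
have [N JN] : exists N, msupported Pi ((\sum_(j | j != i) 'X_j) ^+ N * psi v).
  apply: ideal_pow_sum => // j nji; exists K.
  rewrite mpolyXn; apply/(msupported_locm K Pi).
  apply: (homog_torsion satPi (comp_hsym2_homog i) _ Jpsi).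
  by rewrite comp_hsym2_coeff ?oner_eq0 // eq_sym.
have [q vq] := comp_elim_congr i v.
pose s : {mpoly k[n]} := \sum_(j | j != i) 'X_j.
have [r xr] : exists r, ('X_i : {mpoly k[n]}) ^+ N - (- s) ^+ N = sumX * r.
  by rewrite subrXX opprK /sumX (bigD1 i) //=; eexists.
(* The first term accounts for [v - psi v], the second for replacing [X_i^N] by [(- s)^N]. *)
exists N, ('X_i ^+ N * q + r * psi v).
suff -> : 'X_[U_(i) *+ (N + K)] * v - sumX * ('X_[U_(i) *+ K] * ('X_i ^+ N * q + r * psi v))
  = 'X_[U_(i) *+ K] * ((-1) ^+ N * (s ^+ N * psi v)).
  by apply/msupported_locm; apply: (idealM idPi).
have -> : 'X_[U_(i) *+ (N + K)] = 'X_[U_(i) *+ K] * 'X_i ^+ N :> {mpoly k[n]}.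
  by rewrite -!mpolyXn exprD mulrC.
have vE : v = psi v + sumX * q by rewrite -vq addrC subrK.
rewrite {1}vE.
have -> : (-1) ^+ N * (s ^+ N * psi v) = (- s) ^+ N * psi v.
  by rewrite mulrA -exprMn mulN1r.
have -> : 'X_i ^+ N = (- s) ^+ N + sumX * r :> {mpoly k[n]}.
  by rewrite -xr addrC subrK.
by ring.
Qed.

End RegularPair.

(** * Regular pairs and extension of sections *)

Section DepthTwo.
Local Open Scope ring_scope.
Variables (k : fieldType) (n : nat).
Implicit Types (P : pred 'X_{1..n}) (p q z f g : {mpoly k[n]}) (m : 'X_{1..n}).

Lemma vars_idealX i : vars_ideal ('X_i : {mpoly k[n]}).
Proof. by apply: sub_ideal_gen; exists i. Qed.

Lemma vars_ideal_sumX : vars_ideal (sumX k n).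
Proof.
have idV := ideal_gen_ideal (fun p : {mpoly k[n]} => exists i, p = 'X_i).
by apply: (ideal_sum _ idV) => i _; apply: vars_idealX.
Qed.

Lemma vars_ideal_hsym2 : vars_ideal (hsym2 k n).
Proof.
have idV := ideal_gen_ideal (fun p : {mpoly k[n]} => exists i, p = 'X_i).
by apply: (ideal_sum _ idV) => i _; rewrite mulrC; apply: (idealM idV); apply: vars_idealX.
Qed.

Lemma vars_ideal_mcoeff0 p : vars_ideal p -> p@_0%MM = 0.
Proof.
apply: (ideal_gen_min (Q := fun p : {mpoly k[n]} => p@_0%MM = 0)).
  split=> [|a b a0 b0|a b b0]; first exact: mcoeff0.
    by rewrite mcoeffD a0 b0 addr0.
  by rewrite rmorphM /= b0 mulr0.
by move=> _ [i ->]; rewrite mcoeffX mnm1_eq0.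
Qed.

Lemma add_seq_proper P s : ~~ P 0%MM -> (forall f, f \in s -> vars_ideal f) ->
  ~ ideal_add_seq (msupported P) s (1 : {mpoly k[n]}).
Proof.
move=> nP0 sV /(ideal_gen_min (Q := fun p : {mpoly k[n]} => p@_0%MM = 0)) H.
have /eqP : (1 : {mpoly k[n]})@_0%MM = 0; last by rewrite mcoeff1 eqxx oner_eq0.
apply: H => [|q [Jq|/sV]]; last exact: vars_ideal_mcoeff0.
  split=> [|a b a0 b0|a b b0]; first exact: mcoeff0.
    by rewrite mcoeffD a0 b0 addr0.
  by rewrite rmorphM /= b0 mulr0.
by have /msupportedP/(_ _ nP0) := Jq.
Qed.

Lemma msupported_locm_ge K N P i p : saturated K P ->
  msupported P ('X_[U_(i) *+ N] * p) -> msupported (locm K P i) p.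
Proof.
move=> satP /msupportedP Jp; apply/msupportedP => m nP.
rewrite -(mcoeffXMD (U_(i) *+ N)); apply: Jp; apply: contra nP => /satP; apply=> l.
by rewrite !mnmDE !mulmnE mnm1E; case: eqP => [<-|_] /=; lia.
Qed.

Lemma regular_pair_of_good K P : saturated K P -> ~~ P 0%MM ->
  (forall m, ~~ P m -> degree_connected K P m) ->
  regular_seq (msupported P) [:: sumX k n; hsym2 k n].
Proof.
move=> satP nP0 good; have idJ := msupported_ideal k satP.
apply/(regular_seq2P _ _ idJ); split=> [z|z u Jzu|].
- exact: (sumX_regular satP good).
- have [N_ /fin_all_exists[w_ Jw]] := fin_all_exists (fun i => hsym2_local i satP Jzu).
  (* The local quotients of [z] by [sumX] are brought to denominators with the common exponent
     [M + K]. *)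
  pose M := \max_i N_ i; pose W i := 'X_[U_(i) *+ (M - N_ i)] * w_ i.
  have JW i : msupported P ('X_[U_(i) *+ (M + K)] * z - sumX k n * ('X_[U_(i) *+ K] * W i)).
    have leM : (N_ i <= M)%N by exact: leq_bigmax.
    have := idealM idJ 'X_[U_(i) *+ (M - N_ i)] (Jw i).
    have -> : (M + K = M - N_ i + (N_ i + K))%N by lia.
    rewrite /W -!mpolyXn [in X in _ -> X]exprD => H.
    by move: H; congr msupported; ring.
  have [i j|w Jww] := @glue k n K (M + K) P W satP (leq_addl _ _) good.
    (* After multiplication by [sumX] both sides of the overlap condition become the same multiple
       of [z]. *)
    apply: (sumX_regular satP good).
    have := idealB idJ (idealM idJ 'X_[U_(i) *+ (M + K)] (JW j))
                       (idealM idJ 'X_[U_(j) *+ (M + K)] (JW i)).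
    by congr msupported; ring.
  exists w; apply: (torsion_free satP good) => i; apply/msupported_locm.
  apply: (msupported_locm_ge (N := (M + K)%N) satP).
  have := idealB idJ (JW i) (idealM idJ (sumX k n) (Jww i)).
  by congr msupported; ring.
- apply: add_seq_proper => // f; rewrite !inE => /orP[] /eqP->.
    exact: vars_ideal_sumX.
  exact: vars_ideal_hsym2.
Qed.

(** This is the radical of the colon ideal [Q : z]; it contains [vars_ideal] as soon as it contains
    every variable. *)
Lemma radical_colon_ideal (Q : {mpoly k[n]} -> Prop) z :
  ideal Q -> ideal (fun p => exists a, Q (p ^+ a * z)).
Proof.
move=> idQ; split.
- by exists 1%N; rewrite expr1 mul0r; apply: ideal0.
- by move=> p q [a Qp] [b Qq]; exists (a + b)%N; apply: ideal_powD.
- by move=> p q [a Qq]; exists a; rewrite exprMn -mulrA; apply: idealM.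
Qed.

Lemma vars_ideal_exp N p : vars_ideal p ->
  exists a (c : 'I_n -> {mpoly k[n]}), p ^+ a = \sum_i c i * 'X_[U_(i) *+ N].
Proof.
pose Q (p : {mpoly k[n]}) := exists c : 'I_n -> {mpoly k[n]},
  p = \sum_i c i * 'X_[U_(i) *+ N].
have idQ : ideal Q.
  split.
  - by exists (fun=> 0); rewrite big1 // => i _; rewrite mul0r.
  - move=> _ _ [c ->] [d ->]; exists (fun i => c i + d i).
    by rewrite -big_split; apply: eq_bigr => i _ /=; rewrite mulrDl.
  - move=> q _ [c ->]; exists (fun i => q * c i).
    by rewrite mulr_sumr; apply: eq_bigr => i _; rewrite mulrA.
suff H : vars_ideal p -> exists a, Q (p ^+ a * 1).
  by move=> /H[a [c Hc]]; exists a, c; rewrite -Hc mulr1.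
apply: (ideal_gen_min (radical_colon_ideal 1 idQ)) => _ [i ->].
exists N, (fun j => (j == i)%:R); rewrite (bigD1 i) //= eqxx mul1r mulr1 mpolyXn big1 ?addr0 //.
by move=> j /negPf->; rewrite mul0r.
Qed.

(* The quotients [W i / X_i^N] agree on overlaps, hence define a section away from the
   maximal ideal; a regular pair in that ideal forces it to extend. *)
Lemma regular_pair_glue K P f g N (W : 'I_n -> {mpoly k[n]}) : saturated K P ->
  vars_ideal f -> vars_ideal g -> regular_seq (msupported P) [:: f; g] ->
  (forall i j, msupported P ('X_[U_(j) *+ N] * W i - 'X_[U_(i) *+ N] * W j)) ->
  exists w, forall i, msupported P ('X_[U_(i) *+ N] * w - W i).
Proof.
move=> satP fV gV; have idJ := msupported_ideal k satP.
move=> /(regular_seq2P _ _ idJ)[regf regg _] compat.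
have [a [c fE]] := vars_ideal_exp N fV; have [b [d gE]] := vars_ideal_exp N gV.
(* If [s] denotes the section [W i / X_i^N], then [u] stands for [f^a s] and [v] for [g^b s].
   Regularity of the powers then divides [u] by [f^a]. *)
pose u := \sum_i c i * W i; pose v := \sum_i d i * W i.
have Ju i : msupported P ('X_[U_(i) *+ N] * u - f ^+ a * W i).
  rewrite fE mulr_suml mulr_sumr -sumrB; apply: (ideal_sum _ idJ) => l _.
  have := idealM idJ (c l) (compat l i).
  by congr msupported; ring.
have Juv : msupported P (g ^+ b * u - f ^+ a * v).
  rewrite gE mulr_suml mulr_sumr -sumrB; apply: (ideal_sum _ idJ) => l _.
  have := idealM idJ (d l) (Ju l).
  by congr msupported; ring.
have [w Jw] := regular_mod_exp idJ regf regg Juv.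
exists w => i; apply: (regular_exp (a := a) regf).
have := idealB idJ (Ju i) (idealM idJ 'X_[U_(i) *+ N] Jw).
by congr msupported; ring.
Qed.

Lemma good_of_regular_pair K P f g m : saturated K P ->
  vars_ideal f -> vars_ideal g -> regular_seq (msupported P) [:: f; g] ->
  ~~ P m -> degree_connected K P m.
Proof.
move=> satP fV gV reg nPm; have idJ := msupported_ideal k satP.
have glueW := regular_pair_glue satP fV gV reg.
have [i iP] : exists i, ~~ locm K P i m.
  case: (pickP (fun i => ~~ locm K P i m)) => [i iP|allP]; first by exists i.
  case/negP: nPm; apply/(msupportedX k).
  have [regf _ _] := proj1 (regular_seq2P _ _ idJ) reg.
  (* Without vertices a power of every variable kills ['X_[m]], hence so does a power of [f], which
     contradicts regularity. *)
  suff [a /(regular_exp regf)] : exists a, msupported P (f ^+ a * 'X_[m]) by [].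
  move: fV; apply: (ideal_gen_min (radical_colon_ideal 'X_[m] idJ)) => _ [i ->].
  exists K; rewrite mpolyXn -mpolyXD; apply/msupportedX; rewrite addmC.
  by have /negbFE := allP i.
split.
  have [j /andP[nij gij]|allP] := pickP (fun j => (i != j) && degree_rel K P m i j).
    exists i, j; split=> //; apply: locm_gammar satP _.
    by rewrite degree_rel_sym; apply: gij.
  (* At an isolated vertex [i] the section that is ['X_[M] / X_i^N] on its chart and 0 on the others
     is consistent. It cannot extend, since [N] exceeds the exponent of [X_i] in [M]. *)
  pose N := (K + m i).+1; pose M := (m + U_(i) *+ K)%MM.
  pose W l : {mpoly k[n]} := if l == i then 'X_[M] else 0.
  have [i1 i2|w Jw] := glueW N W.
    have JM l : l != i -> msupported P ('X_[U_(l) *+ N] * 'X_[M] : {mpoly k[n]}).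
      move=> nli; rewrite -mpolyXD; apply/msupportedX.
      move/negbT: (allP l); rewrite eq_sym nli /= negbK => /satP; apply=> t.
      rewrite /M !mnmDE !mulmnE !mnm1E /N.
      by case: (i == t); case: (l == t); lia.
    rewrite /W; case: eqP => [->|/eqP n1]; case: eqP => [->|/eqP n2].
    - by rewrite subrr; apply: (ideal0 idJ).
    - by rewrite mulr0 subr0; apply: JM.
    - by rewrite mulr0 sub0r; apply: (idealN idJ); apply: JM.
    - by rewrite !mulr0 subr0; apply: (ideal0 idJ).
  have /msupportedP/(_ M iP) := Jw i.
  rewrite /W eqxx mcoeffB mcoeffX eqxx mcoeffXM ifF.
    by rewrite sub0r => /eqP; rewrite oppr_eq0 oner_eq0.
  apply/negP => /mnm_lepP/(_ i); rewrite /M mnmDE !mulmnE mnm1E eqxx /N; lia.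
move=> i1 i2 i1P i2P; apply/negPn/negP => ncon.
(* The section is ['X_[m]] on the component of [i1] and 0 on the other charts. An extension would
   have coefficient 1 at [m] by the chart of [i1] and 0 by that of [i2]. *)
pose A l := connect (degree_rel K P m) i1 l.
pose W l : {mpoly k[n]} := if A l then 'X_[U_(l) *+ K] * 'X_[m] else 0.
have [l1 l2|w Jw] := glueW K W.
  have JX s t : A s -> ~~ A t ->
      msupported P ('X_[U_(t) *+ K] * ('X_[U_(s) *+ K] * 'X_[m]) : {mpoly k[n]}).
    move=> As nAt; rewrite -!mpolyXD; apply/msupportedX; rewrite addmC [X in (X + _)%MM]addmC.
    apply: contraR nAt => gst; apply: connect_trans As _; apply: connect1; exact: gst.
  rewrite /W; case: ifP => A1; case: ifP => A2.
  - by rewrite mulrCA subrr; apply: (ideal0 idJ).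
  - by rewrite mulr0 subr0; apply: JX; rewrite ?A2.
  - by rewrite mulr0 sub0r; apply: (idealN idJ); apply: JX; rewrite ?A1.
  - by rewrite !mulr0 subr0; apply: (ideal0 idJ).
have w1 : w@_m = 1.
  have /msupportedP/(_ _ i1P)/eqP := Jw i1.
  rewrite /W /A connect0 -mulrBr addmC mcoeffXMD mcoeffB mcoeffX eqxx subr_eq0.
  by move/eqP.
have /msupportedP/(_ _ i2P) := Jw i2.
by rewrite /W /A (negPf ncon) subr0 addmC mcoeffXMD w1 => /eqP; rewrite oner_eq0.
Qed.

End DepthTwo.

(** * Depth of the square of an edge ideal *)

Section Depth.
Local Open Scope ring_scope.
Variable R : comNzRingType.
Implicit Types (I J : R -> Prop) (f g : R) (s : seq R).

Lemma ideal_add_sub J J' s s' p :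
  (forall q, J q -> J' q) -> {subset s <= s'} ->
  ideal_add_seq J s p -> ideal_add_seq J' s' p.
Proof.
move=> sJ ss' [c cP ->]; exists c => // ag /cP[/sJ Jq|/ss' sq]; [by left | by right].
Qed.

Lemma regular_seq_ext J J' s :
  (forall p, J p <-> J' p) -> regular_seq J s -> regular_seq J' s.
Proof.
move=> eqJ [reg n1]; split=> [i lt_is g Jg|J1].
  apply: (ideal_add_sub (J := J)) (reg i lt_is g _) => // [q /eqJ//|].
  by apply: ideal_add_sub Jg => // q /eqJ.
by apply: n1; apply: ideal_add_sub J1 => // q /eqJ.
Qed.

Lemma regular_seq_pair J f g s :
  regular_seq J (f :: g :: s) -> regular_seq J [:: f; g].
Proof.
case=> reg n1; split=> [i lt_i2 z|J1].
  by case: i lt_i2 (reg i) => [|[|]] //= _; apply.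
apply: n1; apply: ideal_add_sub J1 => // q; rewrite !inE.
by case/orP=> ->; rewrite ?orbT.
Qed.

(** Properness makes the empty sequence regular, so lengths bounded by 1 would have a maximum. Hence
    infinite depth also provides a regular sequence of length at least 2, which is truncated to a
    pair. *)
Lemma depth_gt1P I J : ~ ideal_add_seq J [::] 1 ->
  lt_enat (Some 1%N) (depth_quot I J) <->
  exists f g, [/\ I f, I g & regular_seq J [:: f; g]].
Proof.
move=> n1; split; last first.
  case=> f [g [If Ig reg]]; rewrite /depth_quot.
  case: excluded_middle_informative => // ex.
  case: constructive_indefinite_description => d [_ dmax] /=.
  rewrite /lt_enat /= -ltnNge; apply: dmax; exists [:: f; g]; split=> // h.
  by rewrite !inE => /orP[]/eqP->.
have long d : regular_seq_in I J d -> (1 < d)%N ->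
    exists f g, [/\ I f, I g & regular_seq J [:: f; g]].
  case=> -[|f [|g s]] [<- //= Is reg] _; exists f, g; split.
  - by apply: Is; rewrite mem_head.
  - by apply: Is; rewrite !inE eqxx orbT.
  - exact: regular_seq_pair reg.
rewrite /depth_quot; case: excluded_middle_informative => [ex|nmax _].
  case: constructive_indefinite_description => d [regd _] /=.
  by rewrite /lt_enat /= -ltnNge; apply: long.
case: (excluded_middle_informative (exists f g, [/\ I f, I g & regular_seq J [:: f; g]])) => // nex.
have short d : regular_seq_in I J d -> (d <= 1)%N.
  by move=> regd; rewrite leqNgt; apply/negP => /(long _ regd).
case: nmax; case: (excluded_middle_informative (regular_seq_in I J 1)) => reg1.
  by exists 1%N.
exists 0%N; split; first by exists [::].
by case=> [|[|d]] // /short.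
Qed.

End Depth.

Lemma adj_neq (V : finType) (H : {set {set V}}) x y : is_graph H -> adj H x y -> x != y.
Proof. by move=> gH /gH; rewrite cards2; case: (x == y). Qed.

Lemma adj_sym (V : finType) (H : {set {set V}}) x y : adj H x y = adj H y x.
Proof. by rewrite /adj setUC. Qed.

(** * Monomials in the square of an edge ideal *)

Section SquareMonomials.
Variable n : nat.
Implicit Types (H : {set {set 'I_n}}) (m : 'X_{1..n}).

Definition sqmon H : pred 'X_{1..n} := fun m =>
  [exists e : ('I_n * 'I_n) * ('I_n * 'I_n),
    [&& adj H e.1.1 e.1.2, adj H e.2.1 e.2.2
      & (U_(e.1.1) + U_(e.1.2) + (U_(e.2.1) + U_(e.2.2)) <= m)%MM]].

Lemma sqmonP H m :
  reflect (exists i j a b, [/\ adj H i j, adj H a b &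
             forall t, (i == t) + (j == t) + ((a == t) + (b == t)) <= m t])
          (sqmon H m).
Proof.
apply: (iffP existsP) => [[[[i j] [a b]]] /= /and3P[ij ab /mnm_lepP le_m]|].
  by exists i, j, a, b; split=> // t; have := le_m t; rewrite !mnmDE !mnm1E.
case=> i [j [a [b [ij ab le_m]]]]; exists ((i, j), (a, b)); rewrite /= ij ab.
by apply/mnm_lepP => t; rewrite !mnmDE !mnm1E.
Qed.

(** An edge has distinct ends, so a product of two edges has all exponents at most 2. *)
Lemma sqmon_saturated H : is_graph H -> saturated 2 (sqmon H).
Proof.
move=> gH m m' /sqmonP[i [j [a [b [ij ab le_m]]]]] le_m'.
apply/sqmonP; exists i, j, a, b; split=> // t.
have := le_m t; have := le_m' t.
have : (i == t) + (j == t) <= 1.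
  by have /eqP := adj_neq gH ij; case: (i =P t) => [->|_]; case: (j =P t) => [->|_].
have : (a == t) + (b == t) <= 1.
  by have /eqP := adj_neq gH ab; case: (a =P t) => [->|_]; case: (b =P t) => [->|_].
lia.
Qed.

Local Open Scope ring_scope.

Lemma edge_ideal_sqE (k : fieldType) H (p : {mpoly k[n]}) : is_graph H ->
  ideal_mul (edge_ideal H) (edge_ideal H) p <-> msupported (sqmon H) p.
Proof.
move=> gH; have idJ := msupported_ideal k (sqmon_saturated gH); split.
  apply: (ideal_gen_min idJ) => _ [a [b [Ea Eb ->]]].
  (* This colon ideal allows the two factors to be reduced to generators one after the other. *)
  have idl c : ideal (fun q : {mpoly k[n]} => msupported (sqmon H) (q * c)).
    split=> [|q r Jq Jr|q r Jr]; first by rewrite mul0r; apply: (ideal0 idJ).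
      by rewrite mulrDl; apply: (idealD idJ).
    by rewrite -mulrA; apply: (idealM idJ).
  move: Ea; apply: (ideal_gen_min (idl b)) => _ [i [j [ij ->]]].
  rewrite mulrC; move: Eb.
  apply: (ideal_gen_min (idl ('X_i * 'X_j))) => _ [s [t [st ->]]].
  rewrite -!mpolyXD; apply/msupportedX/sqmonP; exists s, t, i, j; split=> // u.
  by rewrite !mnmDE !mnm1E.
move=> Jp; rewrite [p]mpolyE big_seq.
have idE := ideal_gen_ideal (fun p : {mpoly k[n]} =>
  exists a b, [/\ edge_ideal H a, edge_ideal H b & p = a * b]).
apply: (ideal_sum _ idE) => m /Jp/existsP[[[i j] [s t]] /= /and3P[ij st le_m]].
rewrite -mul_mpolyC -(submK le_m) mpolyXD mulrA; apply: (idealM idE).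
apply: sub_ideal_gen; exists ('X_i * 'X_j), ('X_s * 'X_t); split.
- by apply: sub_ideal_gen; exists i, j.
- by apply: sub_ideal_gen; exists s, t.
- by rewrite !mpolyXD.
Qed.

Lemma depth_edge_ideal_sq (k : fieldType) H : is_graph H ->
  lt_enat (Some 1%N) (depth_quot (@vars_ideal k n)
     (ideal_mul (@edge_ideal k n H) (@edge_ideal k n H))) <->
  forall m, ~~ sqmon H m -> degree_connected 2 (sqmon H) m.
Proof.
move=> gH; set J := ideal_mul _ _; have satP := sqmon_saturated gH.
have eqJ p : J p <-> msupported (sqmon H) p := edge_ideal_sqE p gH.
have nP0 : ~~ sqmon H 0%MM.
  apply/sqmonP => -[i [j [a [b [_ _ /(_ i)]]]]].
  by rewrite mnm0E eqxx.
rewrite depth_gt1P; last first.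
  move=> J1; apply: (add_seq_proper (k := k) (s := [::]) nP0) => //.
  by apply: ideal_add_sub J1 => // q /eqJ.
split=> [[f [g [fV gV reg]]] m|good].
  by apply: good_of_regular_pair fV gV _ => //; apply: regular_seq_ext reg.
exists (sumX k n), (hsym2 k n); split.
- exact: vars_ideal_sumX.
- exact: vars_ideal_hsym2.
- apply: (regular_seq_ext (J := msupported (sqmon H))) => [p|]; first by split=> /eqJ.
  exact: regular_pair_of_good good.
Qed.

End SquareMonomials.

(** * Graphs *)

Section Diameter.
Variable V : finType.
Implicit Types H : {set {set V}}.

Lemma adj_gcompl H x y : adj (gcompl H) x y = (x != y) && ~~ adj H x y.
Proof. by rewrite /adj inE cards2; case: (x == y). Qed.

Lemma le_bigmax_enat (I : finType) (F : I -> enat) c :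
  le_enat (\big[max_enat/Some 0]_(x : I) F x) c <-> forall x, le_enat (F x) c.
Proof.
have leM : {morph le_enat^~ c : a b / max_enat a b >-> a && b}.
  by case: c => [c|] [a|] [b|] //=; rewrite /max_enat /= ?andbF //; case: ifP => /=; lia.
have le0 : le_enat (Some 0) c = true by case: c {leM}.
rewrite (big_morph (le_enat^~ c) leM le0).
by rewrite big_andE; split=> [/fintype.forallP|leF]; [|apply/fintype.forallP].
Qed.

Lemma le_dist H x y d :
  le_enat (dist H x y) (Some d) <-> exists2 e, e <= d & path_of_length H x y e.
Proof.
rewrite /dist.
(* The connectivity proof occurs in the value of the first branch, so the case split is a dependent
   one. *)
refine (match @idP (connect (adj H) x y) as r return
  (le_enat (match r with
            | ReflectT xy => Some (ex_minn (path_of_lengthP xy))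
            | ReflectF _ => None
            end) (Some d) <-> exists2 e, e <= d & path_of_length H x y e)
  with ReflectT xy => _ | ReflectF nxy => _ end) => /=; last first.
  split=> // -[e _ /existsP[p /and3P[hp _ /eqP hy]]].
  by case: nxy; apply/connectP; exists p.
case: ex_minnP => e xye emin; split=> [le_ed|[f le_fd /emin le_ef]].
  by exists e.
exact: leq_trans le_ef le_fd.
Qed.

(** In the complement, distinct vertices not adjacent in [H] have distance 1, so only the edges of
    [H] impose a condition: a midpoint [w]. *)
Lemma diam_gcompl_le2 H : is_graph H ->
  le_enat (diam (gcompl H)) (Some 2) <->
  forall x y, adj H x y ->
    exists w, [/\ w != x, w != y, ~~ adj H w x & ~~ adj H w y].
Proof.
move=> gH; rewrite /diam le_bigmax_enat; split=> [le2 x y xy|mid x].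
  have /le_bigmax_enat/(_ y)/le_dist[e le_e2] := le2 x.
  case/existsP=> -[p /= /eqP sz_p] /and3P[hp _ /eqP hy].
  case: p sz_p hp hy => [|w [|z [|z' p]]] /= sz_p; last by lia.
  - by move=> _ exy; have := adj_neq gH xy; rewrite exy eqxx.
  - by rewrite adj_gcompl => /andP[/andP[_ nxw] _] ewy; rewrite ewy xy in nxw.
  - rewrite !adj_gcompl => /and3P[/andP[nxw xw] /andP[nwz wz] _] ezy; exists w.
    by rewrite -ezy eq_sym nxw nwz (adj_sym H w x).
apply/le_bigmax_enat => y; apply/le_dist.
have [<-|nxy] := eqVneq x y.
  by exists 0 => //; apply/existsP; exists [tuple]; rewrite /= eqxx.
have [xy|nadj] := boolP (adj H x y); last first.
  exists 1 => //; apply/existsP; exists [tuple y].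
  by rewrite /= adj_gcompl inE nxy nadj eqxx.
have [w [wx wy nwx nwy]] := mid x y xy.
exists 2 => //; apply/existsP; exists [tuple w; y].
rewrite /= !adj_gcompl !inE negb_or eqxx !(eq_sym x) wx wy nwy adj_sym nwx.
by rewrite eq_sym nxy.
Qed.

End Diameter.

(** * Degree graphs of the square of an edge ideal *)

Section SquareCombinatorics.
Variables (n : nat) (H : {set {set 'I_n}}).
Hypothesis gH : is_graph H.
Implicit Types (a b : 'X_{1..n}) (U : {set 'I_n}).

Local Notation adj := (adj H).
Local Notation P := (sqmon H).
Local Notation gam a := (degree_rel 2 (sqmon H) a).

Lemma adj_irr x : adj x x = false.
Proof. by apply/negP => /(adj_neq gH); rewrite eqxx. Qed.

Lemma gam_val a x y t :
  (a + U_(x) *+ 2 + U_(y) *+ 2)%MM t = a t + (x == t) * 2 + (y == t) * 2.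
Proof. by rewrite 2!mnmDE !mulmnE !mnm1E. Qed.

Lemma gam_sym a x y : gam a x y = gam a y x.
Proof. exact: degree_rel_sym. Qed.

(** By saturation [X_x^4] acts like [X_x^2]. Vertices are thus the loops of [gam], and one relation
    records both vertices and edges. *)
Lemma locm_gam a x : ~~ locm 2 P x a = gam a x x.
Proof.
rewrite /degree_rel /locm; congr (~~ _); apply/idP/idP => /(sqmon_saturated gH); apply=> t.
  by rewrite gam_val mnmDE mulmnE mnm1E; lia.
by rewrite gam_val mnmDE mulmnE mnm1E; lia.
Qed.

Lemma degree_connected_hub a h q : q != h -> gam a q q -> gam a h h ->
  (forall x, gam a x x -> connect (gam a) x h) -> degree_connected 2 P a.
Proof.
move=> nqh gq gh hub; split.
  by exists q, h; rewrite !locm_gam.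
move=> x y; rewrite !locm_gam => /hub xh /hub yh; apply: connect_trans xh _.
by rewrite (sym_connect_sym (gam_sym a)).
Qed.

(** Membership in the square is shown with the edges [i j] and [s u]; the exponent inequality at [t]
    is split by the ends equal to [t]. *)
Local Ltac sq_witness i j s u :=
  apply/sqmonP; exists i, j, s, u; split=> //; let t := fresh in intro t; rewrite ?gam_val;
  case: (i =P t) => [?|_]; case: (j =P t) => [?|_];
  case: (s =P t) => [?|_]; case: (u =P t) => [?|_]; subst;
  try match goal with h : is_true (?x != ?x) |- _ => by case/eqP: h end;
  try match goal with h : is_true (adj ?x ?x) |- _ => by rewrite adj_irr in h end;
  try done; lia.

Lemma sqmon_disjoint a i j s t : adj i j -> adj s t ->
  s != i -> s != j -> t != i -> t != j ->
  0 < a i -> 0 < a j -> 0 < a s -> 0 < a t -> P a.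
Proof. by move=> ij st ? ? ? ? ? ? ? ?; sq_witness i j s t. Qed.

Lemma sqmon_cherry a i j l : adj j i -> adj j l -> l != i ->
  1 < a j -> 0 < a i -> 0 < a l -> P a.
Proof. by move=> ji jl ? ? ? ?; sq_witness j i j l. Qed.

Lemma sqmon_double a i j : adj i j -> 1 < a i -> 1 < a j -> P a.
Proof. by move=> ij ? ?; sq_witness i j i j. Qed.

Lemma sqmonN_indep b :
  (forall s t, 0 < b s -> 0 < b t -> ~~ adj s t) -> ~~ P b.
Proof.
move=> ind; apply/sqmonP => -[i [j [s [t [ij _ leb]]]]]; apply: (negP (ind i j _ _)) ij.
  by have := leb i; rewrite eqxx; lia.
by have := leb j; rewrite eqxx; lia.
Qed.

(** Any two edges in the support both contain [v], so their product would need exponent 2 there. *)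
Lemma sqmonN_star b v : b v <= 1 ->
  (forall s t, 0 < b s -> 0 < b t -> adj s t -> s = v \/ t = v) -> ~~ P b.
Proof.
move=> bv star; apply/sqmonP => -[i [j [s [t [ij st leb]]]]].
have := leb v; have iv : i = v \/ j = v.
  by apply: star ij; [have := leb i | have := leb j]; rewrite eqxx; lia.
have sv : s = v \/ t = v.
  by apply: star st; [have := leb s | have := leb t]; rewrite eqxx; lia.
by case: iv => ->; case: sv => ->; rewrite !eqxx; lia.
Qed.

(** With exponents at most 1 on [U], two edges would have to use four distinct vertices of [U]. *)
Lemma sqmonN_triangle b U : #|U| = 3 -> (forall t, t \in U -> b t <= 1) ->
  (forall s t, 0 < b s -> 0 < b t -> adj s t -> s \in U /\ t \in U) -> ~~ P b.
Proof.
move=> U3 bU edges; apply/sqmonP => -[i [j [s [t [ij st leb]]]]].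
have [iU jU] : i \in U /\ j \in U.
  by apply: edges ij; [have := leb i | have := leb j]; rewrite eqxx; lia.
have [sU tU] : s \in U /\ t \in U.
  by apply: edges st; [have := leb s | have := leb t]; rewrite eqxx; lia.
suff : size [:: i; j; s; t] <= size (enum U) by rewrite -cardE U3.
apply: uniq_leq_size => [|x]; last first.
  by rewrite mem_enum !inE => /or4P[] /eqP->.
rewrite /= !inE !negb_or (adj_neq gH ij) (adj_neq gH st) !andbT /=.
have := leb i; have := leb j; have := bU i iU; have := bU j jU.
rewrite !eqxx (eq_sym s i) (eq_sym t i) (eq_sym s j) (eq_sym t j).
by case: (i == s); case: (i == t); case: (j == s); case: (j == t) => /=; lia.
Qed.

Variant sqmonN_spec a : Prop :=
| SqIndep of forall s t, 0 < a s -> 0 < a t -> ~~ adj s t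
| SqStar v i of adj v i & a v = 1 & 0 < a i &
    forall s t, 0 < a s -> 0 < a t -> adj s t -> s = v \/ t = v
| SqTriangle U of is_triangle H U & (forall t, t \in U -> a t = 1) &
    forall s t, 0 < a s -> 0 < a t -> adj s t -> s \in U /\ t \in U.

Lemma sqmonN_star_spec a i j : ~~ P a -> adj i j -> 0 < a i -> 0 < a j ->
  (forall s t, 0 < a s -> 0 < a t -> adj s t -> s = j \/ t = j) ->
  sqmonN_spec a.
Proof.
move=> nP ij ai aj star.
have [aj1|aj2] := leqP (a j) 1.
  by apply: (@SqStar a j i) => //; [rewrite adj_sym | lia].
have only_i l : 0 < a l -> adj j l -> l = i.
  move=> al jl; apply/eqP; apply: contraR nP => nli.
  have ji : adj j i by rewrite adj_sym.
  exact: sqmon_cherry ji jl _ _ _ _.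
apply: (@SqStar a i j) => // [|s t as_ at_ st].
  apply/eqP; rewrite eqn_leq ai andbT leqNgt; apply: contra nP => ai2.
  exact: sqmon_double ij _ _.
case: (star s t) => // e; subst; last by left; apply: only_i; rewrite // adj_sym.
by right; apply: only_i.
Qed.

(** Edges in the support meet pairwise, and a family of pairwise meeting edges is a star or a
    triangle. *)
Lemma sqmonNP a : ~~ P a -> sqmonN_spec a.
Proof.
move=> nP.
have meet i j s t : adj i j -> 0 < a i -> 0 < a j -> adj s t -> 0 < a s -> 0 < a t ->
    [\/ s = i, s = j, t = i | t = j].
  move=> ij ai aj st as_ at_.
  have [->|nsi] := eqVneq s i; first by constructor 1.
  have [->|nsj] := eqVneq s j; first by constructor 2.
  have [->|nti] := eqVneq t i; first by constructor 3.
  have [->|ntj] := eqVneq t j; first by constructor 4.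
  by case/negP: nP; apply: (sqmon_disjoint ij st).
(* An edge that avoids [j] meets [i j] in [i], and so yields a further neighbour of [i]. *)
have avoid i j : adj i j -> 0 < a i -> 0 < a j ->
    (exists x, [/\ adj i x, 0 < a x & x != j]) \/
    (forall s t, 0 < a s -> 0 < a t -> adj s t -> s = j \/ t = j).
  move=> ij ai aj.
  case: (pickP (fun e : 'I_n * 'I_n =>
    [&& adj e.1 e.2, 0 < a e.1, 0 < a e.2, e.1 != j & e.2 != j])); last first.
    move=> none; right=> s t as_ at_ st.
    have /negbT := none (s, t); rewrite /= as_ at_ st /= negb_and !negbK.
    by case/orP=> /eqP; [left | right].
  case=> s t /= /and5P[st as_ at_ nsj ntj]; left.
  case: (meet i j s t) => // e; subst; rewrite ?eqxx // in nsj ntj *.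
    by exists t.
  by exists s; rewrite adj_sym.
case: (pickP (fun e : 'I_n * 'I_n => [&& adj e.1 e.2, 0 < a e.1 & 0 < a e.2])); last first.
  move=> none; apply: SqIndep => s t as_ at_.
  by have /negbT := none (s, t); rewrite /= as_ at_ !andbT.
case=> i j /= /and3P[ij ai aj].
have ji : adj j i by rewrite adj_sym.
have [[x [ix ax nxj]]|star] := avoid i j ij ai aj; last first.
  exact: sqmonN_star_spec nP ij ai aj star.
have [[y [jy ay nyi]]|star] := avoid j i ji aj ai; last first.
  exact: sqmonN_star_spec nP ji aj ai star.
have nij := adj_neq gH ij; have nix := adj_neq gH ix.
(* The edges [i x] and [j y] must meet, and this closes the triangle. *)
have exy : y = x.
  case: (meet i x j y) => // e; subst; rewrite ?eqxx // in nij nxj nyi *.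
subst y; have xj : adj x j by rewrite adj_sym.
have xi : adj x i by rewrite adj_sym.
have a1 u v w : adj u v -> adj u w -> w != v -> 0 < a u -> 0 < a v -> 0 < a w -> a u = 1.
  move=> uv uw nvw au av aw; apply/eqP; rewrite eqn_leq au andbT leqNgt.
  apply: contra nP => au2; exact: sqmon_cherry uv uw _ _ _ _.
apply: (@SqTriangle a [set i; j; x]).
- split; first by rewrite -setUA cardsU1 cards2 !inE negb_or nij nix eq_sym nxj.
  move=> s t; rewrite !inE.
  by case/orP=> [/orP[]|] /eqP->; case/orP=> [/orP[]|] /eqP->; rewrite ?eqxx.
- move=> t; rewrite !inE => /orP[/orP[]|] /eqP->.
  + exact: (a1 i j x).
  + by apply: (a1 j i x); rewrite // eq_sym.
  + by apply: (a1 x i j); rewrite // eq_sym.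
move=> s t as_ at_ st; rewrite !inE.
(* An edge that meets all three sides of a triangle has both ends in it. *)
have m1 := meet _ _ _ _ ij ai aj st as_ at_.
have m2 := meet _ _ _ _ ix ai ax st as_ at_.
have m3 := meet _ _ _ _ jy aj ax st as_ at_.
move: nij nix nxj; case: m1 => ?; case: m2 => ?; case: m3 => ?; subst.
all: by rewrite ?eqxx ?orbT.
Qed.

Lemma gam_supp a x y t :
  0 < (a + U_(x) *+ 2 + U_(y) *+ 2)%MM t -> [\/ 0 < a t, t = x | t = y].
Proof.
rewrite gam_val; case: (x =P t) => [->|_]; first by constructor 2.
case: (y =P t) => [->|_]; first by constructor 3.
by rewrite !addn0; constructor 1.
Qed.

Lemma gam_val_out a x y t : x != t -> y != t ->
  (a + U_(x) *+ 2 + U_(y) *+ 2)%MM t = a t.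
Proof. by move=> /negPf nx /negPf ny; rewrite gam_val nx ny !addn0. Qed.

Lemma gam_nadj a x y : gam a x y -> ~~ adj x y.
Proof. by apply: contra => xy; sq_witness x y x y. Qed.

Lemma gam_indep a x y : ~~ adj x y ->
  (forall s t, 0 < a s -> 0 < a t -> ~~ adj s t) ->
  (forall t, 0 < a t -> ~~ adj x t /\ ~~ adj y t) -> gam a x y.
Proof.
move=> nxy ind out; apply: sqmonN_indep => s t.
have nyx : ~~ adj y x by rewrite adj_sym.
case/gam_supp => [as_|->|->]; case/gam_supp => [at_|->|->]; rewrite ?adj_irr //.
- exact: ind.
- by rewrite adj_sym; case: (out s).
- by rewrite adj_sym; case: (out s).
- by case: (out t).
- by case: (out t).
Qed.

(** The exponent of [v] is not raised, and [v] still covers every edge of the enlarged support. *)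
Lemma gam_star a v x y : ~~ adj x y -> a v <= 1 -> x != v -> y != v ->
  (forall s t, 0 < a s -> 0 < a t -> adj s t -> s = v \/ t = v) ->
  (forall t, 0 < a t -> adj x t \/ adj y t -> t = v) -> gam a x y.
Proof.
move=> nxy av xv yv star out; apply: (sqmonN_star (v := v)).
  by rewrite gam_val_out.
have nyx : ~~ adj y x by rewrite adj_sym.
move=> s t; case/gam_supp => [as_|->|->]; case/gam_supp => [at_|->|->];
  rewrite ?adj_irr ?(negPf nxy) ?(negPf nyx) // => st.
- exact: star.
- by left; apply: out => //; left; rewrite adj_sym.
- by left; apply: out => //; right; rewrite adj_sym.
- by right; apply: out => //; left.
- by right; apply: out => //; right.
Qed.

Lemma gam_triangle a U x y : is_triangle H U -> (forall t, t \in U -> a t = 1) ->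
  (forall s t, 0 < a s -> 0 < a t -> adj s t -> s \in U /\ t \in U) ->
  ~~ adj x y -> (forall t, 0 < a t -> ~~ adj x t) ->
  (forall t, 0 < a t -> ~~ adj y t) -> gam a x y.
Proof.
move=> [U3 triU] aU edges nxy outx outy.
have nyx : ~~ adj y x by rewrite adj_sym.
have other t : t \in U -> exists2 u, u \in U & adj t u.
  move=> tU; have : 0 < #|U :\ t| by have := cardsD1 t U; rewrite tU U3; lia.
  case/card_gt0P=> u; rewrite !inE => /andP[nut uU]; exists u => //.
  by apply: triU; rewrite // eq_sym.
(* A vertex of the triangle has a neighbour in the support, so [x] and [y] lie outside [U] and the
   exponents on [U] stay 1. *)
have outU z : (forall t, 0 < a t -> ~~ adj z t) -> forall t, t \in U -> z != t.
  move=> outz t tU; apply/eqP => ezt; have [u uU tu] := other t tU.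
  by have := outz u; rewrite aU // ezt tu => /(_ isT).
apply: (sqmonN_triangle U3) => [t tU|s t].
  by rewrite gam_val_out ?aU //; apply: outU tU.
case/gam_supp => [as_|->|->]; case/gam_supp => [at_|->|->];
  rewrite ?adj_irr ?(negPf nxy) ?(negPf nyx) ?(negPf (outx _ _)) ?(negPf (outy _ _)) //.
- exact: edges.
- by rewrite adj_sym (negPf (outx _ _)).
- by rewrite adj_sym (negPf (outy _ _)).
Qed.

(** The first of several obstructions: the raised exponents of [x] and [y] complete two edges to a
    product in the square. *)
Lemma gam_pair a x y r t : adj x r -> adj y t -> t != r -> 0 < a r -> 0 < a t ->
  ~~ gam a x y.
Proof. by move=> xr yt ntr ar at_; rewrite negbK; sq_witness x r y t. Qed.

Lemma gam_refl_cherry a x r t : adj x r -> adj x t -> t != r -> 0 < a r -> 0 < a t ->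
  ~~ gam a x x.
Proof. exact: gam_pair. Qed.

Lemma gam_refl_double a x r : adj x r -> 1 < a r -> ~~ gam a x x.
Proof. by move=> xr ar; rewrite negbK; sq_witness x r x r. Qed.

Lemma gam_refl_common a x r v : adj x r -> adj v r -> 1 < a r -> 0 < a v -> ~~ gam a x x.
Proof. by move=> xr vr ar av; rewrite negbK; sq_witness x r v r. Qed.

Lemma gam_refl_disjoint a x r v t : adj x r -> adj v t -> r != v -> r != t ->
  0 < a r -> 0 < a v -> 0 < a t -> ~~ gam a x x.
Proof. by move=> xr vt nrv nrt ar av at_; rewrite negbK; sq_witness x r v t. Qed.

Lemma triangle_others U t : #|U| = 3 ->
  exists x y, [/\ x \in U, y \in U, x != y, x != t & y != t].
Proof.
move=> U3; have : 1 < #|U :\ t| by have := cardsD1 t U; rewrite U3; lia.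
case/card_gt1P=> x [y [xU yU nxy]]; exists x, y.
by move: xU yU; rewrite !inE => /andP[-> ->] /andP[-> ->].
Qed.

(** The triangle has an edge that avoids [t]; multiplied by the edge [x t] it lies in the square. *)
Lemma triangle_vertex a U x t : is_triangle H U -> (forall t, t \in U -> a t = 1) ->
  gam a x x -> 0 < a t -> ~~ adj x t.
Proof.
move=> [U3 triU] aU gx at_; apply: contraL gx => xt.
have [y [z [yU zU nyz nyt nzt]]] := triangle_others t U3.
by apply: (gam_refl_disjoint xt (triU y z yU zU nyz)); rewrite ?(aU y yU) ?(aU z zU) // 1?eq_sym.
Qed.

Lemma mem_nbhdC U x : (x \in ~: nbhd H U) = [forall u in U, ~~ adj u x].
Proof. by rewrite !inE negb_exists; apply: eq_forallb => u; rewrite negb_and implybE. Qed.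

Lemma nbhdCP U x : reflect (forall u, u \in U -> ~~ adj x u) (x \in ~: nbhd H U).
Proof.
rewrite mem_nbhdC; apply: (iffP fintype.forall_inP) => out u uU.
  by rewrite adj_sym; apply: out.
by rewrite adj_sym; apply: out.
Qed.

Lemma adj_induced W x y :
  Defs.adj (induced (gcompl H) W) x y = [&& x != y, ~~ adj x y, x \in W & y \in W].
Proof.
rewrite [LHS]inE -/(Defs.adj (gcompl H) x y) adj_gcompl -andbA; congr [&& _, _ & _].
by rewrite subUset !sub1set.
Qed.

Lemma degree_connected_of_conditions a :
  (exists x y, adj x y) ->
  (forall x y, adj x y -> exists w, [/\ w != x, w != y, ~~ adj w x & ~~ adj w y]) ->
  (forall U, is_triangle H U ->
     (2 <= #|~: nbhd H U|)%N /\ is_connected (gcompl H) (~: nbhd H U)) ->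
  ~~ P a -> degree_connected 2 P a.
Proof.
move=> [x0 [y0 xy0]] mid tri nP.
have n_xy0 := adj_neq gH xy0.
case: (sqmonNP nP) => [ind|v i vi av ai star|U triU aU edges].
- have indS x y : 0 < a x -> 0 < a y -> gam a x y.
    move=> ax ay; apply: gam_indep => // [|t at_]; first exact: ind.
    by split; apply: ind.
  have [[p q] /= /and3P[npq ap aq]|single] :=
    pickP (fun e : 'I_n * 'I_n => [&& e.1 != e.2, 0 < a e.1 & 0 < a e.2]).
    apply: (@degree_connected_hub a q p) => //; [exact: indS | exact: indS | move=> x gx].
    have [ax|ax0] := posnP (a x); last exact/connect1/indS.
    (* A vertex [x] outside the support has at most one neighbour [r] in it, and is linked to all
       other support vertices; if [r] is the hub [q], the path goes through [p]. *)
    have [r /andP[ar xr]|none] := pickP (fun r => (0 < a r) && adj x r); last first.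
      apply: connect1; apply: gam_indep => //.
      + by have := none q; rewrite aq /= => ->.
      + by move=> t at_; split; [have := none t; rewrite at_ /= => -> | apply: ind].
    have ar1 : a r <= 1.
      by rewrite leqNgt; apply: contraL gx; apply: gam_refl_double.
    have onlyr t : 0 < a t -> adj x t -> t = r.
      move=> at_ xt; apply/eqP; apply: contraTT gx => ntr.
      exact: (gam_refl_cherry xr xt).
    have nxr := adj_neq gH xr.
    have step s : 0 < a s -> s != r -> gam a x s.
      move=> as_ nsr; apply: (gam_star (v := r)) => //.
      + by apply: contra nsr => xs; apply/eqP/onlyr.
      + by move=> s' t' as' at' st; have := ind s' t' as' at'; rewrite st.
      + move=> t at_ [|st]; first exact: onlyr.
        by have := ind s t as_ at_; rewrite st.
    have [eqr|nqr] := eqVneq q r; last exact/connect1/step.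
    apply: (connect_trans (y := p)); apply: connect1; last exact: indS.
    by apply: step => //; rewrite -eqr.
  have [p ponly] : exists p, forall t, 0 < a t -> t = p.
    case: (pickP (fun t => 0 < a t)) => [p ap|none]; last first.
      by exists x0 => t at_; have := none t; rewrite at_.
    exists p => t at_; apply/eqP; have /negbT := single (t, p).
    by rewrite /= at_ ap !andbT negbK.
  have [ap1|ap2] := leqP (a p) 1.
    (* For exponent at most 1 at [p] the graph contains the whole complement of [H], which is
       connected by midpoints. *)
    have all_gam x y : ~~ adj x y -> gam a x y.
      move=> nxy; have [exp|nxp] := eqVneq x p.
        apply: gam_indep => // t /ponly ->; rewrite -exp adj_irr; split=> //.
        by rewrite adj_sym.
      have [eyp|nyp] := eqVneq y p.
        by apply: gam_indep => // t /ponly ->; rewrite -eyp adj_irr.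
      apply: (gam_star (v := p)) => // [s t /ponly-> _ _|t /ponly-> //].
      by left.
    apply: (@degree_connected_hub a x0 y0); rewrite 1?eq_sym ?all_gam ?adj_irr // => x _.
    have [xx0|nxx0] := boolP (adj x x0); last exact/connect1/all_gam.
    have [w [_ _ wx wx0]] := mid x x0 xx0.
    apply: (connect_trans (y := w)); apply/connect1/all_gam => //.
    by rewrite adj_sym.
  have gp x : ~~ adj x p -> gam a x p.
    by move=> nxp; apply: gam_indep => // t /ponly->; rewrite adj_irr.
  (* With exponent at least 2 the hub is [p]; a second vertex comes from the midpoint condition. *)
  have [q nqp nadj_qp] : exists2 q, q != p & ~~ adj q p.
    have [z nzp] : exists z, z != p.
      have [exp|nxp] := eqVneq x0 p; last by exists x0.
      by exists y0; rewrite -exp eq_sym.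
    have [zp|nzp'] := boolP (adj z p); last by exists z.
    by have [w [_ wp _ nwp]] := mid z p zp; exists w.
  apply: (@degree_connected_hub a p q) => //.
  + by apply: gam_indep; rewrite ?adj_irr // => t /ponly->.
  + by apply: gp; rewrite adj_irr.
  move=> x gx; apply/connect1/gp; apply: contraL gx => xp.
  exact: gam_refl_double xp _.
- have nvi := adj_neq gH vi.
  have ind s t : 0 < a s -> 0 < a t -> s != v -> t != v -> ~~ adj s t.
    move=> as_ at_ /eqP nsv /eqP ntv; apply/negP => st.
    by case: (star s t as_ at_ st).
  have step p : p != v -> (forall t, 0 < a t -> adj p t -> t = v) -> gam a p i.
    move=> npv pout; apply: (gam_star (v := v)); rewrite ?av // 1?eq_sym //.
    + by apply/negP => /(pout i ai)/eqP; rewrite eq_sym (negPf nvi).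
    + move=> t at_ [|it]; first exact: pout.
      by apply/eqP; apply: contraTT it => ntv; apply: ind; rewrite // eq_sym.
  have gi : gam a i i.
    apply: step => [|t at_ it]; first by rewrite eq_sym.
    by apply/eqP; apply: contraTT it => ntv; apply: ind; rewrite // eq_sym.
  (* The hub is [i]. The second vertex [p] is a further support vertex or, failing that, a midpoint
     for [v i]; its link to [v] provides a detour. *)
  have [p [npi npv pout gp pj]] : exists p, [/\ p != i, p != v,
      forall t, 0 < a t -> adj p t -> t = v, gam a p p &
      ((forall t, 0 < a t -> adj v t -> t = i) -> a i <= 1 -> gam a p v)].
    suff [p [npi npv pout pv]] : exists p, [/\ p != i, p != v,
        forall t, 0 < a t -> adj p t -> t = v &
        ((forall t, 0 < a t -> adj v t -> t = i) -> ~~ adj p v)].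
      exists p; split=> //.
        apply: (gam_star (v := v)); rewrite ?adj_irr ?av // => t at_ [] pt; exact: pout.
      move=> vout ai1; have npv' := pv vout.
      apply: (gam_star (v := i)) => // [s t as_ at_ st|t at_ [pt|]].
      + case: (star s t as_ at_ st) => e; subst.
          by right; apply: vout.
        by left; apply: vout; rewrite // adj_sym.
      + by move: npv'; rewrite -(pout t at_ pt) pt.
      + exact: vout.
    have [p /and3P[ap npi npv]|none] :=
      pickP (fun p => [&& 0 < a p, p != i & p != v]).
      exists p; split=> // [t at_ pt|vout].
        by apply/eqP; apply: contraTT pt => ntv; apply: ind.
      apply: contra npi => pv; apply/eqP/vout => //.
      by rewrite adj_sym.
    have onlyiv t : 0 < a t -> t = i \/ t = v.
      move=> at_; have /negbT := none t.
      by rewrite at_ /= negb_and !negbK => /orP[] /eqP; [left | right].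
    have [w [nwv nwi wv wi]] := mid v i vi; exists w; split=> // t /onlyiv[]-> //.
    by rewrite (negPf wi).
  apply: (@degree_connected_hub a i p) => // x gx.
  (* A neighbour [r] other than [v] forces [r = i], of exponent 1, as the only support neighbour of
     [v]; the path is then [x], [v], [p], [i]. *)
  have [r /and3P[ar nrv xr]|none] := pickP (fun r => [&& 0 < a r, r != v & adj x r]); last first.
    have xout t : 0 < a t -> adj x t -> t = v.
      by move=> at_ xt; have /negbT := none t; rewrite at_ xt andbT negbK => /eqP.
    apply/connect1/step => //; apply/eqP => exv.
    by rewrite exv in xout; move/eqP: (xout i ai vi); rewrite eq_sym (negPf nvi).
  have vout t : 0 < a t -> adj v t -> t = r.
    move=> at_ vt; apply/eqP; apply: contraTT gx => ntr.
    by apply: (gam_refl_disjoint xr vt); rewrite ?av // eq_sym.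
  have eir := vout i ai vi; subst r.
  have ai1 : a i <= 1.
    by rewrite leqNgt; apply: contraL gx => ai2; apply: (gam_refl_common xr vi); rewrite ?av.
  have xout t : 0 < a t -> adj x t -> t = i.
    move=> at_ xt; apply/eqP; apply: contraTT gx => nti.
    exact: (gam_refl_cherry xr xt).
  have av0 : 0 < a v by rewrite av.
  apply: (connect_trans (y := v)).
    apply: connect1; apply: (gam_star (v := i)) => //.
    + by apply/negP => /(xout v av0)/eqP; rewrite (negPf nvi).
    + exact: adj_neq gH xr.
    + move=> s t as_ at_ st; case: (star s t as_ at_ st) => e; subst.
        by right; apply: vout.
      by left; apply: vout; rewrite // adj_sym.
    + by move=> t at_ []; [apply: xout | apply: vout].
  apply: (connect_trans (y := p)); apply: connect1.
    by rewrite gam_sym; apply: pj.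
  exact: step.
have [U3 triU'] := triU.
have vertexP x : gam a x x -> forall t, 0 < a t -> ~~ adj x t.
  by move=> gx t at_; apply: (triangle_vertex triU aU gx at_).
have gamP := gam_triangle triU aU edges.
have aU0 t : t \in U -> 0 < a t by move=> /aU->.
have [/card_gt1P[x1 [y1 [x1W y1W nxy1]]] conn] := tri U triU.
(* If the support is [U], the graph contains the induced complement of condition (b). A support
   vertex [p] outside [U] is itself a hub. *)
have [p /andP[ap pU]|none] := pickP (fun p => (0 < a p) && (p \notin U)); last first.
  have suppU t : 0 < a t -> t \in U.
    by move=> at_; have /negbT := none t; rewrite at_ /= negbK.
  have WP x : x \in ~: nbhd H U -> forall t, 0 < a t -> ~~ adj x t.
    by move/nbhdCP => out t /suppU; apply: out.
  apply: (@degree_connected_hub a y1 x1); rewrite ?gamP ?adj_irr //; try exact: WP.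
  move=> x /vertexP xout; have xW : x \in ~: nbhd H U.
    by apply/nbhdCP => u /aU0; apply: xout.
  have := conn x y1 xW y1W; apply: connect_sub => s t.
  by rewrite adj_induced => /and4P[_ nst sW tW]; apply/connect1/gamP => //; apply: WP.
have pout t : 0 < a t -> ~~ adj p t.
  by move=> at_; apply: contra pU => pt; case: (edges p t ap at_ pt).
(* If [p] is the only support vertex outside [U], its neighbour in the induced complement of
   condition (b) serves. *)
have [q nqp qout] : exists2 q, q != p & forall t, 0 < a t -> ~~ adj q t.
  have [q /and3P[aq qU nqp]|none] :=
    pickP (fun q => [&& 0 < a q, q \notin U & q != p]).
    exists q => // t at_; apply: contra qU => qt.
    by case: (edges q t aq at_ qt).
  have pW : p \in ~: nbhd H U by apply/nbhdCP => u /aU0; apply: pout.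
  have [z zW nzp] : exists2 z, z \in ~: nbhd H U & p != z.
    have [epx|npx] := eqVneq p x1; last by exists x1.
    by exists y1; rewrite // epx.
  have [q nqp] := connect_step (conn p z pW zW) nzp.
  rewrite adj_induced => /and4P[_ npq _ /nbhdCP qout]; exists q => // t at_.
  have [/qout//|tU] := boolP (t \in U).
  have /negbT := none t; rewrite at_ tU /= negbK => /eqP->.
  by rewrite adj_sym.
have gr z : (forall t, 0 < a t -> ~~ adj z t) -> gam a z z.
  by move=> zout; apply: gamP; rewrite ?adj_irr.
apply: (@degree_connected_hub a p q); rewrite ?gr //.
by move=> x /vertexP xout; apply/connect1/gamP => //; apply: xout.
Qed.

(** The graph of [x_x x_y] has [x] and [y] as vertices. If no midpoint exists, no path leaves the
    non-neighbours of [x], whereas [y] is a neighbour of [x]. *)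
Lemma mid_of_degree_connected :
  (forall a, ~~ P a -> degree_connected 2 P a) ->
  forall x y, adj x y -> exists w, [/\ w != x, w != y, ~~ adj w x & ~~ adj w y].
Proof.
move=> good x y xy.
have [w /and4P[? ? ? ?]|none] :=
  pickP (fun w => [&& w != x, w != y, ~~ adj w x & ~~ adj w y]); first by exists w.
have nxy := adj_neq gH xy.
pose a := (U_(x) + U_(y))%MM.
have aE t : a t = (x == t) + (y == t) by rewrite mnmDE !mnm1E.
have supp t : 0 < a t -> t = x \/ t = y.
  by rewrite aE; case: eqP; [left | case: eqP; [right | ]].
have ax : a x = 1 by rewrite aE eqxx eq_sym (negPf nxy).
have ay : a y = 1 by rewrite aE eqxx (negPf nxy).
have stary s t : 0 < a s -> 0 < a t -> adj s t -> s = y \/ t = y.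
  by move=> /supp[]-> /supp[]->; rewrite ?adj_irr //; auto.
have starx s t : 0 < a s -> 0 < a t -> adj s t -> s = x \/ t = x.
  by move=> /supp[]-> /supp[]->; rewrite ?adj_irr //; auto.
have nPa : ~~ P a by apply: (sqmonN_star (v := x)); rewrite ?ax.
have gx : gam a x x.
  apply: (gam_star (v := y)); rewrite ?ay ?adj_irr // => t /supp[]-> //.
  by rewrite adj_irr => -[].
have gy : gam a y y.
  apply: (gam_star (v := x)); rewrite ?ax ?adj_irr 1?eq_sym // => t /supp[]-> //.
  by rewrite adj_irr => -[].
have [_ /(_ x y)] := good a nPa; rewrite !locm_gam => /(_ gx gy)/connectP[s].
have : ~~ adj x x by rewrite adj_irr.
(* Invariant along the path: [z] is not adjacent to [x]. For [z] other than [x], the missing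
   midpoint makes [z] adjacent to [y], and [gam_pair] excludes a step to a neighbour of [x]. *)
move: {1 3 4}x => z; elim: s z => [|z' s IH] z nzx /=.
  by move=> _ ezy; move: nzx; rewrite -ezy adj_sym xy.
case/andP=> gzz'; apply: IH; apply: contraL gzz' => z'x.
have [ezx|nzx'] := eqVneq z x.
  by apply: contraTN z'x; rewrite ezx adj_sym; apply: gam_nadj.
have zy : adj z y.
  have nzy : z != y by apply: contraNneq nzx => ->; rewrite adj_sym.
  by have /negbT := none z; rewrite nzx' nzy nzx /= negbK.
by apply: gam_pair zy z'x _ _ _; rewrite ?ax ?ay.
Qed.

(** For the squarefree monomial of the triangle, the vertices of the graph are the elements of
    [~: nbhd H U], and its edges between distinct vertices are non-edges of [H]. *)
Lemma triangle_of_degree_connected U :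
  (forall a, ~~ P a -> degree_connected 2 P a) -> is_triangle H U ->
  (2 <= #|~: nbhd H U|)%N /\ is_connected (gcompl H) (~: nbhd H U).
Proof.
move=> good triU; have [U3 _] := triU.
pose a : 'X_{1..n} := [multinom (t \in U : nat) | t < n].
have aU t : t \in U -> a t = 1 by rewrite mnmE => ->.
have supp t : 0 < a t -> t \in U by rewrite mnmE; case: (t \in U).
have edges s t : 0 < a s -> 0 < a t -> adj s t -> s \in U /\ t \in U.
  by move=> /supp ? /supp.
have vertexP x : gam a x x -> x \in ~: nbhd H U.
  by move=> gx; apply/nbhdCP => u uU; apply: (triangle_vertex triU aU gx); rewrite aU.
have WP x : x \in ~: nbhd H U -> forall t, 0 < a t -> ~~ adj x t.
  by move/nbhdCP => out t /supp; apply: out.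
have [|[x [y [nxy]]]] := good a.
  by apply: (sqmonN_triangle U3) => // t tU; rewrite aU.
rewrite !locm_gam => gx gy conn; split.
  by apply/card_gt1P; exists x, y; split=> //; apply: vertexP.
move=> s t sW tW.
have gW z : z \in ~: nbhd H U -> gam a z z.
  by move=> zW; apply: (gam_triangle triU aU edges); rewrite ?adj_irr //; apply: WP.
have := conn s t; rewrite !locm_gam !gW // => /(_ isT isT).
apply: connect_sub => u v guv; have [->|nuv] := eqVneq u v; first exact: connect0.
apply: connect1; rewrite adj_induced nuv (gam_nadj guv) /=.
apply/andP; split; apply: vertexP; rewrite -locm_gam.
  exact: locm_gammar (sqmon_saturated gH) guv.
by rewrite gam_sym in guv; exact: locm_gammar (sqmon_saturated gH) guv.
Qed.

End SquareCombinatorics.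

Theorem theorem4p8 (k : fieldType) (n : nat) (H : {set {set 'I_n}})
    (H_graph : is_graph H) (H_edge : H != set0) :
  lt_enat (Some 1)
    (depth_quot (@vars_ideal k n)
       (ideal_mul (@edge_ideal k n H) (@edge_ideal k n H)))
  <->
  le_enat (diam (gcompl H)) (Some 2) /\
  (forall U : {set 'I_n}, is_triangle H U ->
     (2 <= #|~: nbhd H U|)%N /\ is_connected (gcompl H) (~: nbhd H U)).
Proof.
rewrite (depth_edge_ideal_sq k H_graph) (diam_gcompl_le2 H_graph).
split=> [good|[mid tri] a]; last first.
  apply: degree_connected_of_conditions => //.
  have /set0Pn[e eH] := H_edge.
  have /eqP/cards2P[x [y [_ exy]]] := H_graph e eH.
  by exists x, y; rewrite /adj -exy.
by split=> [|U]; [apply: mid_of_degree_connected | apply: triangle_of_degree_connected].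
Qed.
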